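(* Let $m,s\ge 1$ and $t_1,\dots,t_m\ge 1$ be integers. For each $p=1,\dots,m$ let $A^p=(A^p_{ij})_{i,j=1}^s\in M_s(M_{t_p})$ be a positive semidefinite $st_p\times st_p$ complex matrix partitioned into $t_p\times t_p$ blocks $A^p_{ij}$. Put $\sigma_p=t_p^{-1}\prod_{q=1}^m t_q$. Then $$\Bigl|\bigodot_{p=1}^m A^p\Bigr|\ \ge\ \prod_{p=1}^m\prod_{i=1}^s|A^p_{ii}|^{\sigma_p}-\prod_{p=1}^m\Bigl\{\prod_{i=1}^s|A^p_{ii}|^{\sigma_p}-|A^p|^{\sigma_p}\Bigr\}.$$ Moreover, if every $A^p$ is positive definite, equality holds if and only if one of the following holds: (a) $m=1$ or $s=1$; (b) there is $p$ such that $A^p$ is block diagonal (i.e. $A^p_{ij}=0$ for all $i\ne j$); (c) $t_p=1$ for every $p$ (so $A^p\in M_s$), and there exist indices $i\neq j$ in $\{1,\dots,s\}$ (the same for all $p$) such that for every $p$ all entries of $A^p$ vanish except the diagonal entries and the $(i,j)$ and $(j,i)$ entries.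
   Context: $|X|$ denotes the determinant of a square matrix $X$. For block matrices $A^p=(A^p_{ij})_{i,j=1}^s$, $p=1,\dots,m$, the Hadamard (Khatri–Rao) product is the block matrix $\bigodot_{p=1}^mA^p=(A^1_{ij}\otimes\cdots\otimes A^m_{ij})_{i,j=1}^s$, where $\otimes$ is the Kronecker product; here it is a square matrix of size $s\prod_q t_q$. *)

(* Defs.v *)
From HB Require Import structures.
From mathcomp Require Import all_boot all_order all_algebra.
From mathcomp Require Import reals.
From mathcomp.real_closed Require Import complex.
Set Implicit Arguments. Unset Strict Implicit. Unset Printing Implicit Defensive.
Import Order.TTheory GRing.Theory Num.Theory.
Local Open Scope ring_scope.

Definition ctrmx (C : numClosedFieldType) n (M : 'M[C]_n) : 'M[C]_n :=
  (map_mx Num.conj M)^T.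

Definition psdmx (C : numClosedFieldType) n (M : 'M[C]_n) : Prop :=
  ctrmx M = M /\ forall x : 'cV[C]_n, 0 <= ((map_mx Num.conj x)^T *m M *m x) 0 0.

Definition pdmx (C : numClosedFieldType) n (M : 'M[C]_n) : Prop :=
  ctrmx M = M /\ forall x : 'cV[C]_n, x != 0 -> 0 < ((map_mx Num.conj x)^T *m M *m x) 0 0.

(* block index: the row/column i*t + k of an (s t) x (s t) matrix,
   i.e. position k inside block i (blocks numbered 0..s-1, positions 0..t-1) *)
Lemma blk_proof s t (i : 'I_s) (k : 'I_t) : (i * t + k < s * t)%N.
Proof.
have hi := ltn_ord i; have hk := ltn_ord k.
apply: (@leq_trans (i * t + t)); first by rewrite ltn_add2l.
by rewrite -mulSnr leq_mul2r hi orbT.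
Qed.
Definition blk s t (i : 'I_s) (k : 'I_t) : 'I_(s * t) := Ordinal (blk_proof i k).

Definition block_of (C : Type) s t (A : 'M[C]_(s * t)) (i j : 'I_s) : 'M[C]_t :=
  \matrix_(k, l) A (blk i k) (blk j l).

(* multi-indices for the Kronecker product A^1_ij (x) ... (x) A^m_ij *)
Definition KIdx m (t : 'I_m -> nat) := {dffun forall p : 'I_m, 'I_(t p)}.

(* Khatri-Rao (block Hadamard) product of the A^p, indexed by
   'I_s * KIdx t (block index, Kronecker multi-index), transported to an
   ordinary square matrix of size #|'I_s * KIdx t| = s * prod_q t_q
   via the canonical enumeration (this simultaneous reindexing of rows
   and columns does not affect the determinant). *)
Definition khatri_rao (C : comNzRingType) m s (t : 'I_m -> nat)
  (A : forall p : 'I_m, 'M[C]_(s * t p)) : 'M[C]_(#|{: 'I_s * KIdx t}|) :=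
  \matrix_(a, b)
    let ik : 'I_s * KIdx t := enum_val a in
    let jl : 'I_s * KIdx t := enum_val b in
    \prod_(p < m) A p (blk ik.1 (ik.2 p)) (blk jl.1 (jl.2 p)).

Definition sigma m (t : 'I_m -> nat) (p : 'I_m) : nat := ((\prod_(q < m) t q) %/ t p)%N.

Definition block_diag (C : ringType) s t (A : 'M[C]_(s * t)) : Prop :=
  forall i j : 'I_s, i != j -> block_of A i j = 0.

(* Main.v *)
Require Import Defs.
From HB Require Import structures.
From mathcomp Require Import all_boot all_order all_algebra.
From mathcomp Require Import reals.
From mathcomp.real_closed Require Import complex mxtens.
From mathcomp Require Import perm ring.
Set Implicit Arguments. Unset Strict Implicit. Unset Printing Implicit Defensive.
Import Order.TTheory GRing.Theory Num.Theory.
Local Open Scope ring_scope.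

(* Assume first that every A^p is positive definite, and eliminate the blocks one
   at a time.  Let X^p be the Schur complement of the trailing blocks in A^p.  Then
   A^p - (X^p (+) 0) is still positive semidefinite, hence so is its Khatri-Rao
   product, and the Khatri-Rao product of the A^p exceeds it by
   N = (x)A^p_11 - (x)(A^p_11 - X^p) in the first diagonal block.  So |K| is at
   least |N| times the determinant of the trailing part of K.  Diagonalising each
   pair (A^p_11, X^p) by a common congruence, with relative eigenvalues x in (0, 1],
   |N| is |(x)A^p_11| times a product of terms h(v) := 1 - prod_p (1 - v_p).
   Now h(v) is the probability that some event p occurs, which gives
   h(v) h(w) >= h(vw); multiplying up yields the bound.  The semidefinite case
   follows by adding e I and letting e tend to 0.

   Strictness of h(v) h(w) >= h(vw) leaves three possibilities in the case of
   equality: m = 1, some A^p block diagonal, or all t_p = 1 with every A^p zero off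
   the diagonal and one row and column k.  For such arrowhead matrices both sides
   are explicit, and equality reads sum_j prod_p c^p_j = prod_p sum_j c^p_j with
   nonnegative c^p_j = |a^p_kj|^2 / a^p_jj, which forces a single common j. *)

(** * Supermultiplicativity of 1 - prod (1 - v) *)

Section ProbabilityOr.
Variable R : numDomainType.
Implicit Types a b c d : R.

(** Consider two independent trials of two independent events, with probabilities [a], [b] and then
    [c], [d]. The gap is the probability that the first trial yields exactly one event and the
    second exactly the other. *)
Lemma or_mul_le a b c d :
  0 <= a <= 1 -> 0 <= b <= 1 -> 0 <= c <= 1 -> 0 <= d <= 1 ->
  a * c + b * d - a * c * (b * d) <= (a + b - a * b) * (c + d - c * d).
Proof.
move=> /andP[a0 a1] /andP[b0 b1] /andP[c0 c1] /andP[d0 d1].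
rewrite -subr_ge0.
have -> : (a + b - a * b) * (c + d - c * d) - (a * c + b * d - a * c * (b * d)) =
   a * (1 - b) * (d * (1 - c)) + b * (1 - a) * (c * (1 - d)) by ring.
by rewrite addr_ge0 // !mulr_ge0 // subr_ge0.
Qed.

Lemma or_mul_lt a b c d :
  0 < a < 1 -> 0 <= b < 1 -> 0 <= c < 1 -> 0 < d < 1 ->
  a * c + b * d - a * c * (b * d) < (a + b - a * b) * (c + d - c * d).
Proof.
move=> /andP[a0 a1] /andP[b0 b1] /andP[c0 c1] /andP[d0 d1].
rewrite -subr_gt0.
have -> : (a + b - a * b) * (c + d - c * d) - (a * c + b * d - a * c * (b * d)) =
   a * (1 - b) * (d * (1 - c)) + b * (1 - a) * (c * (1 - d)) by ring.
rewrite ltr_pwDl ?mulr_gt0 ?subr_gt0 //.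
by rewrite !mulr_ge0 // subr_ge0 ltW.
Qed.

Lemma or_ge0 a b : 0 <= a <= 1 -> 0 <= b -> 0 <= a + b - a * b.
Proof.
move=> /andP[a0 a1] b0.
have -> : a + b - a * b = a + (1 - a) * b by ring.
by rewrite addr_ge0 // mulr_ge0 // subr_ge0.
Qed.

Lemma prod_itv01 (I : finType) (P : pred I) (a : I -> R) :
  (forall i, 0 <= a i <= 1) -> 0 <= \prod_(i | P i) a i <= 1.
Proof.
move=> a01; apply/andP; split; last by apply: prodr_ile1 => i _; apply: a01.
by apply: prodr_ge0 => i _; have /andP[] := a01 i.
Qed.

Lemma or_prod_le (I : finType) (P : pred I) (a b : I -> R) :
  (forall i, 0 <= a i <= 1) -> (forall i, 0 <= b i <= 1) ->
  \prod_(i | P i) a i + \prod_(i | P i) b i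
    - \prod_(i | P i) a i * \prod_(i | P i) b i
  <= \prod_(i | P i) (a i + b i - a i * b i).
Proof.
move=> a01 b01.
(* The relation carries the bounds on both products because [or_mul_le] asks for them at each
   multiplication. *)
pose K (x y z : R) := [/\ 0 <= x <= 1, 0 <= y <= 1 & x + y - x * y <= z].
suff [] : K (\prod_(i | P i) a i) (\prod_(i | P i) b i)
            (\prod_(i | P i) (a i + b i - a i * b i)) by [].
apply: (big_ind3 K) => [|x1 x2 y1 y2 z1 z2 [x01 y01 z01] [x02 y02 z02]|i _] //.
- by split; rewrite ?ler01 ?lexx // mulr1 addrK.
- have /andP[x10 x11] := x01; have /andP[y10 y11] := y01.
  have /andP[x20 x21] := x02; have /andP[y20 y21] := y02.
  split; rewrite ?mulr_ge0 ?mulr_ile1 //=.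
  apply: (le_trans (or_mul_le x01 y01 x02 y02)).
  by apply: ler_pM => //; apply: or_ge0.
Qed.

(* [1 - \prod (1 - v p)] is the probability that some event [p] occurs: requiring
   a common [p] for two independent trials is a smaller event. *)
Lemma some_mul_le (I : finType) (v w : I -> R) :
  (forall i, 0 <= v i <= 1) -> (forall i, 0 <= w i <= 1) ->
  1 - \prod_i (1 - v i * w i)
    <= (1 - \prod_i (1 - v i)) * (1 - \prod_i (1 - w i)).
Proof.
move=> v01 w01.
have c01 (u : I -> R) : (forall i, 0 <= u i <= 1) -> forall i, 0 <= 1 - u i <= 1.
  by move=> h i; have /andP[u0 u1] := h i; rewrite subr_ge0 u1 lerBlDr lerDl.
(* Applied to complements, where [(1 - v) + (1 - w) - (1 - v) * (1 - w)] is [1 - v * w]. *)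
have := or_prod_le predT (c01 _ v01) (c01 _ w01).
rewrite [X in _ <= X -> _](eq_bigr (fun i => 1 - v i * w i)); last first.
  by move=> i _; ring.
move=> h; rewrite lerBlDr -lerBlDl; apply: le_trans h.
by rewrite le_eqVlt; apply/orP; left; apply/eqP; ring.
Qed.

(** Iterates [some_mul_le], peeling the trials [x] off a list one by one. *)
Lemma prod_some_ge (T I : finType) (P : pred T) (v : T -> I -> R) :
  (forall x i, 0 <= v x i <= 1) ->
  1 - \prod_i (1 - \prod_(x | P x) v x i) <= \prod_(x | P x) (1 - \prod_i (1 - v x i)).
Proof.
move=> v01; rewrite -(big_filter (index_enum T)).
under [X in 1 - X]eq_bigr => i _ do rewrite -(big_filter (index_enum T)).
elim: [seq x <- _ | _] => [|x s IHs].
  rewrite big_nil; under eq_bigr => i _ do rewrite big_nil subrr.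
  by rewrite lerBlDr lerDl prodr_ge0.
rewrite big_cons; under eq_bigr => i _ do rewrite big_cons.
have s01 i : 0 <= \prod_(j <- s) v j i <= 1.
  apply/andP; split; last by apply: prodr_ile1 => j _; apply: v01.
  by apply: prodr_ge0 => j _; have /andP[] := v01 j i.
apply: (le_trans (some_mul_le (v01 x) s01)).
apply: ler_wpM2l => //; rewrite subr_ge0.
have /andP[//] : 0 <= \prod_i (1 - v x i) <= 1.
apply: prod_itv01 => i; have /andP[u0 u1] := v01 x i.
by rewrite subr_ge0 u1 lerBlDr lerDl.
Qed.

Lemma some_gt0 (I : finType) (v : I -> R) : (0 < #|I|)%N ->
  (forall i, 0 < v i <= 1) -> 0 < 1 - \prod_i (1 - v i).
Proof.
case/card_gt0P=> i0 _ v01; rewrite subr_gt0 (bigD1 i0) //=.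
have h i : 0 <= 1 - v i <= 1.
  by have /andP[u0 u1] := v01 i; rewrite subr_ge0 u1 lerBlDr lerDl ltW.
have /andP[p0 p1] := prod_itv01 (fun i => i != i0) h.
have /andP[u0 u1] := v01 i0.
apply: (@le_lt_trans _ _ (1 - v i0)); last by rewrite ltrBlDr ltrDl.
by rewrite ler_piMr // subr_ge0.
Qed.

(** Outside the three cases, two distinct indices [p'], [q'] have [a p'] and [b q'] nonzero.
    [or_mul_lt] is strict on that pair, and the remaining factors are positive, so strictness
    survives the product. *)
Lemma or_prod_eq (I : finType) (a b : I -> R) :
  (1 < #|I|)%N -> (forall i, 0 <= a i < 1) -> (forall i, 0 <= b i < 1) ->
  \prod_i (a i + b i - a i * b i) =
    \prod_i a i + \prod_i b i - \prod_i a i * \prod_i b i ->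
  [\/ exists i, a i = 0 /\ b i = 0, forall i, a i = 0 | forall i, b i = 0].
Proof.
move=> I2 a01 b01 E.
have aW i : 0 <= a i <= 1 by have /andP[-> /ltW] := a01 i.
have bW i : 0 <= b i <= 1 by have /andP[-> /ltW] := b01 i.
have apos i : a i != 0 -> 0 < a i < 1.
  by move=> h; have /andP[h0 ->] := a01 i; rewrite lt_neqAle eq_sym h h0.
have bpos i : b i != 0 -> 0 < b i < 1.
  by move=> h; have /andP[h0 ->] := b01 i; rewrite lt_neqAle eq_sym h h0.
case: (pickP (fun i => (a i == 0) && (b i == 0))) => [i /andP[/eqP ? /eqP ?]|N0].
  by constructor 1; exists i.
case: (pickP (fun i => a i != 0)) => [p ap|a0]; last first.
  by constructor 2 => i; apply/eqP; rewrite -[_ == _]negbK a0.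
case: (pickP (fun i => b i != 0)) => [q bq|b0]; last first.
  by constructor 3 => i; apply/eqP; rewrite -[_ == _]negbK b0.
exfalso.
have [p' [q' [npq ap' bq']]] : exists p' q', [/\ p' != q', a p' != 0 & b q' != 0].
  have [Epq|npq] := eqVneq p q; last by exists p, q.
  (* When [p] and [q] coincide, a second index [r] takes over one of the two roles, since [a r] and
     [b r] are not both zero. *)
  have [r rp] : exists r, r != p.
    have /card_gt0P[r] : (0 < #|predC1 p|)%N by rewrite cardC1 -subn1 subn_gt0.
    by rewrite !inE => rp; exists r.
  have := N0 r; case: (eqVneq (a r) 0) => [_ /= br|ar _].
    by exists p, r; rewrite eq_sym rp ap br.
  by exists r, q; rewrite -Epq rp ar Epq.
have gpos i : 0 < a i + b i - a i * b i.
  have -> : a i + b i - a i * b i = a i * (1 - b i) + b i by ring.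
  have /andP[a0 a1] := a01 i; have /andP[b0 b1] := b01 i.
  have [ai0|ai] := eqVneq (a i) 0.
    have := N0 i; rewrite ai0 eqxx /= mul0r add0r => /negbT /bpos.
    by case/andP.
  by rewrite ltr_pwDl // mulr_gt0 ?subr_gt0 //; case/andP: (apos _ ai).
have := or_prod_le (fun i => (i != p') && (i != q')) aW bW.
have D (f : I -> R) :
    \prod_i f i = f p' * (f q' * \prod_(i | (i != p') && (i != q')) f i).
  by rewrite (bigD1 p') //= (bigD1 q') //= eq_sym.
move: E; rewrite (D a) (D b) (D (fun i => a i + b i - a i * b i)).
set x := \prod_(i | _) a i; set y := \prod_(i | _) b i; set z := \prod_(i | _) _.
move=> E le_z.
have x01 : 0 <= x <= 1 by apply: prod_itv01.
have y01 : 0 <= y <= 1 by apply: prod_itv01.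
have z0 : 0 < z by apply: prodr_gt0.
have lt1 := or_mul_lt (apos _ ap') (b01 p') (a01 q') (bpos _ bq').
have A01 : 0 <= a p' * a q' <= 1.
  by have /andP[? ?] := aW p'; have /andP[? ?] := aW q'; rewrite mulr_ge0 ?mulr_ile1.
have B01 : 0 <= b p' * b q' <= 1.
  by have /andP[? ?] := bW p'; have /andP[? ?] := bW q'; rewrite mulr_ge0 ?mulr_ile1.
have h1 := or_mul_le A01 B01 x01 y01.
have h2 := ler_wpM2l (or_ge0 A01 (proj1 (andP B01))) le_z.
have := lt_le_trans (le_lt_trans (le_trans h1 h2) (_ : _ < _)) (lexx _).
move/(_ ((a p' + b p' - a p' * b p') * (a q' + b q' - a q' * b q') * z)).
rewrite ltr_pM2r // => /(_ lt1).
by rewrite -[X in _ < X]mulrA E !mulrA ltxx.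
Qed.

Lemma prod_le1_eq1 (T : finType) (P : pred T) (v : T -> R) :
  (forall x, 0 <= v x <= 1) -> \prod_(x | P x) v x = 1 -> forall x, P x -> v x = 1.
Proof.
move=> v01 E x Px; move: E; rewrite (bigD1 x) //= => E.
have /andP[v0 v1] := v01 x; apply: le_anti; rewrite v1 /= -E ler_piMr //.
by have /andP[] := prod_itv01 (fun i => P i && (i != x)) v01.
Qed.

(** Separates one trial [x] from the product [w] of the others. Equality overall forces equality in
    [some_mul_le] for [v x] and [w], and [or_prod_eq] on the complements lists the cases. The choice
    of [x] with some [v x i0 != 1] excludes a trivial trial [x]. *)
Lemma prod_some_eq (T I : finType) (v : T -> I -> R) :
  (1 < #|I|)%N -> (forall x i, 0 < v x i <= 1) ->
  \prod_x (1 - \prod_i (1 - v x i)) = 1 - \prod_i (1 - \prod_x v x i) ->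
  (exists i, forall x, v x i = 1) \/
  (exists x, forall y i, y != x -> v y i = 1).
Proof.
move=> I2 v01 E.
have vW x i : 0 <= v x i <= 1 by have /andP[/ltW-> ->] := v01 x i.
have I1 : (0 < #|I|)%N by apply: ltnW.
case: (pickP (fun i => [forall x, v x i == 1])) => [i /forallP h|N1].
  by left; exists i => x; apply/eqP.
right; have /card_gt0P[i0 _] := I1.
have /existsP[x xi0] : [exists x, v x i0 != 1] by rewrite -negb_forall N1.
exists x; pose w i := \prod_(y | y != x) v y i.
have w01 i : 0 < w i <= 1.
  rewrite prodr_gt0 => [|y _]; last by case/andP: (v01 y i).
  by have /andP[] := prod_itv01 (fun y => y != x) (fun y => vW y i).
have wW i : 0 <= w i <= 1 by have /andP[/ltW-> ->] := w01 i.
have hx := some_gt0 I1 (v01 x).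
have h1 := some_mul_le (vW x) wW.
have h2 := ler_wpM2l (ltW hx) (prod_some_ge (fun y => y != x) vW).
have Ew : 1 - \prod_i (1 - v x i * w i) =
          (1 - \prod_i (1 - v x i)) * (1 - \prod_i (1 - w i)).
  apply: le_anti; rewrite h1 /=; apply: (le_trans h2).
  move: E; rewrite (bigD1 x) //= => ->.
  by under eq_bigr => i _ do rewrite (bigD1 x) //=.
have c01 (u : R) : 0 < u <= 1 -> 0 <= 1 - u < 1.
  by case/andP=> u0 u1; rewrite subr_ge0 u1 ltrBlDr ltrDl.
have c0 (u : R) : 1 - u = 0 -> u = 1 by move/eqP; rewrite subr_eq0 => /eqP.
have w1 i y : w i = 1 -> y != x -> v y i = 1.
  by move=> wi yx; apply: (prod_le1_eq1 (P := fun y => y != x) _ wi).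
have [||||h|h] := @or_prod_eq I (fun i => 1 - v x i) (fun i => 1 - w i) I2.
- by move=> i; apply: c01.
- by move=> i; apply: c01.
- rewrite (eq_bigr (fun i => 1 - v x i * w i)); last by move=> i _; ring.
  rewrite -[LHS](subKr 1) Ew; ring.
- case=> i [/c0 vi /c0 wi]; have /negP[] := N1 i; apply/forallP => y.
  by have [->|yx] := eqVneq y x; rewrite ?vi // w1.
- by case/eqP: xi0; apply/c0/h.
- by move=> y i; apply: w1; apply/c0/h.
Qed.

End ProbabilityOr.

(** * Positive definite matrices *)

Section Hermitian.
Variable C : numClosedFieldType.

Definition adjmx m n (M : 'M[C]_(m, n)) : 'M[C]_(n, m) := (map_mx Num.conj M)^T.
Local Notation "M ^H" := (adjmx M) (at level 8, format "M ^H").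

Lemma adjmxE m n (M : 'M[C]_(m, n)) i j : M^H i j = (M j i)^*.
Proof. by rewrite !mxE. Qed.

Lemma adjmxM m n k (M : 'M[C]_(m, n)) (N : 'M[C]_(n, k)) : (M *m N)^H = N^H *m M^H.
Proof. by rewrite /adjmx map_mxM trmx_mul. Qed.

Lemma adjmxK m n (M : 'M[C]_(m, n)) : M^H^H = M.
Proof. by apply/matrixP => i j; rewrite !mxE conjCK. Qed.

Lemma adjmxD m n (M N : 'M[C]_(m, n)) : (M + N)^H = M^H + N^H.
Proof. by apply/matrixP => i j; rewrite !mxE rmorphD. Qed.

Lemma adjmx0 m n : (0 : 'M[C]_(m, n))^H = 0.
Proof. by apply/matrixP => i j; rewrite !mxE rmorph0. Qed.

Lemma adjmx1 n : (1%:M : 'M[C]_n)^H = 1%:M.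
Proof. by apply/matrixP => i j; rewrite !mxE rmorphMn rmorph1 eq_sym. Qed.

Lemma adj_row_mx m n k (M : 'M[C]_(m, n)) (N : 'M[C]_(m, k)) :
  (row_mx M N)^H = col_mx M^H N^H.
Proof. by rewrite /adjmx map_row_mx tr_row_mx. Qed.

Lemma adj_col_mx m n k (M : 'M[C]_(m, n)) (N : 'M[C]_(k, n)) :
  (col_mx M N)^H = row_mx M^H N^H.
Proof. by rewrite /adjmx map_col_mx tr_col_mx. Qed.

Lemma adj_block_mx m n k l (a : 'M[C]_(m, n)) (b : 'M[C]_(m, k))
    (c : 'M[C]_(l, n)) (d : 'M[C]_(l, k)) :
  (block_mx a b c d)^H = block_mx a^H c^H b^H d^H.
Proof. by rewrite /adjmx map_block_mx tr_block_mx. Qed.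

Lemma adj_diag_real n (d : 'rV[C]_n) :
  (forall i, d 0 i \is Num.real) -> (diag_mx d)^H = diag_mx d.
Proof.
move=> dR; apply/matrixP => i j; rewrite !mxE eq_sym rmorphMn /=.
by case: eqP => [->|_]; rewrite ?mulr0n // !mulr1n; apply/CrealP.
Qed.

Lemma det_adj n (M : 'M[C]_n) : \det M^H = (\det M)^*.
Proof. by rewrite det_tr det_map_mx. Qed.

Lemma psdmx_form n (M : 'M[C]_n) (x : 'cV_n) :
  psdmx M -> 0 <= (x^H *m M *m x) 0 0.
Proof. by case=> _; apply. Qed.

Lemma psdmx_adj n (M : 'M[C]_n) : psdmx M -> M^H = M.
Proof. by case. Qed.

Lemma pdmx_adj n (M : 'M[C]_n) : pdmx M -> M^H = M.
Proof. by case. Qed.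

Lemma pdmxW n (M : 'M[C]_n) : pdmx M -> psdmx M.
Proof.
case=> hM pM; split=> // x; have [->|x0] := eqVneq x 0; last exact/ltW/pM.
by rewrite mulmx0 mxE.
Qed.

Lemma psdmx_congr n k (M : 'M[C]_n) (B : 'M[C]_(n, k)) :
  psdmx M -> psdmx (B^H *m M *m B).
Proof.
move=> pM; split=> [|x].
  by rewrite -[ctrmx _]/(adjmx _) !adjmxM adjmxK (psdmx_adj pM) mulmxA.
have := psdmx_form (B *m x) pM.
by rewrite adjmxM !mulmxA.
Qed.

Lemma pdmx_congr n k (M : 'M[C]_n) (B : 'M[C]_(n, k)) :
  pdmx M -> (forall x : 'cV_k, B *m x = 0 -> x = 0) -> pdmx (B^H *m M *m B).
Proof.
move=> pM Binj; split=> [|x x0].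
  by have [] := psdmx_congr B (pdmxW pM).
have Bx0 : B *m x != 0 by apply: contra x0 => /eqP/Binj->.
have := pM.2 _ Bx0; rewrite -[(map_mx _ _)^T]/(adjmx _) adjmxM.
by rewrite !mulmxA.
Qed.

Lemma pdmx_congr_unit n (M B : 'M[C]_n) :
  pdmx M -> B \in unitmx -> pdmx (B^H *m M *m B).
Proof.
move=> pM uB; apply: pdmx_congr => // x Bx.
by rewrite -[x](mulKmx uB) Bx mulmx0.
Qed.

Lemma psdmxD n (M N : 'M[C]_n) : psdmx M -> psdmx N -> psdmx (M + N).
Proof.
move=> pM pN; split=> [|x].
  by rewrite -[ctrmx _]/(adjmx _) adjmxD (psdmx_adj pM) (psdmx_adj pN).
by rewrite mulmxDr mulmxDl mxE addr_ge0 //; apply: psdmx_form.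
Qed.

Lemma pdmxD n (M N : 'M[C]_n) : psdmx M -> pdmx N -> pdmx (M + N).
Proof.
move=> pM pN; split=> [|x x0].
  by have [] := psdmxD pM (pdmxW pN).
rewrite mulmxDr mulmxDl mxE ltr_wpDl //; first exact: psdmx_form.
exact: pN.2.
Qed.

Lemma psdmx0 n : psdmx (0 : 'M[C]_n).
Proof.
split=> [|x]; first by rewrite -[ctrmx _]/(adjmx _) adjmx0.
by rewrite mulmx0 mul0mx mxE.
Qed.

Lemma psdmx_sum n (I : finType) (F : I -> 'M[C]_n) :
  (forall i, psdmx (F i)) -> psdmx (\sum_i F i).
Proof. by move=> h; apply: big_ind => // *; [apply: psdmx0 | apply: psdmxD]. Qed.

Lemma form_diag n (d : 'rV[C]_n) (x : 'cV[C]_n) :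
  (x^H *m diag_mx d *m x) 0 0 = \sum_i d 0 i * `|x i 0| ^+ 2.
Proof.
rewrite mxE; apply: eq_bigr => i _; rewrite mul_mx_diag mxE adjmxE.
by rewrite normCK; ring.
Qed.

Lemma pdmx_diag n (d : 'rV[C]_n) : (forall i, 0 < d 0 i) -> pdmx (diag_mx d).
Proof.
move=> d0; split=> [|x x0].
  by apply: adj_diag_real => i; apply: gtr0_real.
rewrite -[(map_mx _ _)^T]/(adjmx _) form_diag.
have [i xi] : exists i, x i 0 != 0.
  apply/existsP; rewrite -negb_forall; apply: contra x0 => /forallP x0.
  by apply/eqP/colP => i; rewrite mxE; apply/eqP.
rewrite (bigD1 i) //= ltr_pwDl ?mulr_gt0 ?exprn_gt0 ?normr_gt0 //.
by apply: sumr_ge0 => j _; rewrite mulr_ge0 ?exprn_ge0 // ltW.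
Qed.

Lemma diag_form n (d : 'rV[C]_n) i :
  ((delta_mx i 0 : 'cV[C]_n)^H *m diag_mx d *m (delta_mx i 0 : 'cV[C]_n)) 0 0 = d 0 i.
Proof.
rewrite form_diag (bigD1 i) //= mxE !eqxx normr1 expr1n mulr1 big1 ?addr0 // => j ji.
by rewrite mxE (negbTE ji) normr0 expr0n mulr0.
Qed.

Lemma psdmx_diagP n (d : 'rV[C]_n) : psdmx (diag_mx d) -> forall i, 0 <= d 0 i.
Proof. by move=> pd i; rewrite -(diag_form d i); apply: psdmx_form. Qed.

Lemma pdmx_diagP n (d : 'rV[C]_n) : pdmx (diag_mx d) -> forall i, 0 < d 0 i.
Proof.
move=> pd i; rewrite -(diag_form d i); apply: pd.2.
by apply/negP => /eqP/colP/(_ i); rewrite !mxE !eqxx => /eqP; rewrite oner_eq0.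
Qed.

Lemma pdmx1 n : pdmx (1%:M : 'M[C]_n).
Proof. by rewrite -diag_const_mx; apply: pdmx_diag => i; rewrite mxE ltr01. Qed.

Lemma hermitian_diag n (M : 'M[C]_n) : M^H = M ->
  exists (U : 'M[C]_n) (d : 'rV[C]_n), U *m U^H = 1%:M /\ M = U^H *m diag_mx d *m U.
Proof.
move=> hM; exists (spectralmx M), (spectral_diag M).
have Uu := spectral_unitarymx M.
have EH : (spectralmx M)^H = map_mx Num.conj (spectralmx M)^T.
  by rewrite /adjmx map_trmx.
split; first by rewrite EH; apply/unitarymxP.
rewrite EH -invmx_unitary //; apply/orthomx_spectralP/hermitian_normalmx.
by apply/is_hermitianmxP; rewrite expr0 scale1r -{1}hM /adjmx map_trmx.
Qed.

Lemma adjmx_unitary n (U : 'M[C]_n) : U *m U^H = 1%:M -> U^H *m U = 1%:M.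
Proof. exact: mulmx1C. Qed.

Lemma psdmx_spectral n (M : 'M[C]_n) : psdmx M ->
  exists (U : 'M[C]_n) (d : 'rV[C]_n),
    [/\ U *m U^H = 1%:M, M = U^H *m diag_mx d *m U & forall i, 0 <= d 0 i].
Proof.
move=> pM; have [U [d [UU E]]] := hermitian_diag (psdmx_adj pM).
exists U, d; split=> //; apply: psdmx_diagP.
have := psdmx_congr U^H pM.
by rewrite adjmxK E !mulmxA UU mul1mx -mulmxA UU mulmx1.
Qed.

Lemma psdmx_gram n (M : 'M[C]_n) : psdmx M -> exists G : 'M[C]_n, M = G^H *m G.
Proof.
move=> /psdmx_spectral[U [d [UU E d0]]].
exists (diag_mx (\row_i sqrtC (d 0 i)) *m U); rewrite adjmxM adj_diag_real.
  rewrite !mulmxA -[U^H *m _ *m _]mulmxA mulmx_diag E; congr (_ *m diag_mx _ *m _).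
  by apply/rowP => i; rewrite !mxE -expr2 sqrtCK.
by move=> i; rewrite mxE ger0_real // sqrtC_ge0.
Qed.

Lemma psdmx_det_ge0 n (M : 'M[C]_n) : psdmx M -> 0 <= \det M.
Proof.
by move=> /psdmx_gram[G ->]; rewrite det_mulmx det_adj mulrC mul_conjC_ge0.
Qed.

Lemma pdmx_unit n (M : 'M[C]_n) : pdmx M -> M \in unitmx.
Proof.
move=> pM; rewrite -unitmx_tr -row_free_unit -kermx_eq0; apply/eqP.
apply/row_matrixP => i; rewrite row0.
have : row i (kermx M^T) *m M^T = 0 by rewrite -row_mul mulmx_ker row0.
move/(congr1 trmx); rewrite trmx_mul trmxK trmx0 => E.
apply: trmx_inj; rewrite trmx0; apply/eqP; apply: contraT => /(pM.2).
by rewrite -mulmxA E mulmx0 mxE ltxx.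
Qed.

Lemma pdmx_det_gt0 n (M : 'M[C]_n) : pdmx M -> 0 < \det M.
Proof.
move=> pM; rewrite lt_neqAle psdmx_det_ge0 ?andbT; last exact: pdmxW.
by have := pdmx_unit pM; rewrite unitmxE unitfE eq_sym.
Qed.

Lemma psdmx_unit_pd n (M : 'M[C]_n) : psdmx M -> \det M != 0 -> pdmx M.
Proof.
move=> pM; have [G E] := psdmx_gram pM; rewrite E det_mulmx mulf_eq0 negb_or.
case/andP=> _ G0; have := pdmx_congr_unit (pdmx1 n) (_ : G \in unitmx).
by rewrite mulmx1 => h; apply: h; rewrite unitmxE unitfE.
Qed.

(** With [N = G^H *m G], a unitary [U] diagonalises the congruence of [M] by the inverse of [G];
    then [P] is [U *m G]. *)
Lemma simultaneous_diag n (N M : 'M[C]_n) : pdmx N -> psdmx M ->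
  exists (P : 'M[C]_n) (d : 'rV[C]_n),
    [/\ P \in unitmx, N = P^H *m P & M = P^H *m diag_mx d *m P].
Proof.
move=> pN pM; have [G E] := psdmx_gram (pdmxW pN).
have uG : G \in unitmx.
  by have := pdmx_unit pN; rewrite E unitmx_mul => /andP[].
have [U [d [UU Ed _]]] := psdmx_spectral (psdmx_congr (invmx G) pM).
have uU : U \in unitmx by have [] := mulmx1_unit UU.
exists (U *m G), d; split; first by rewrite unitmx_mul uU.
  by rewrite adjmxM mulmxA -[_ *m U]mulmxA adjmx_unitary // mulmx1.
transitivity (G^H *m ((invmx G)^H *m M *m invmx G) *m G).
  by rewrite !mulmxA -adjmxM mulVmx // adjmx1 mul1mx -mulmxA mulVmx // mulmx1.
by rewrite Ed adjmxM !mulmxA.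
Qed.

(** In coordinates where [N] is the identity, [X + N] is diagonal with entries at least 1. *)
Lemma det_psd_add_ge n (X N : 'M[C]_n) : psdmx X -> pdmx N -> \det N <= \det (X + N).
Proof.
move=> pX pN; have [P [d [uP EN EX]]] := simultaneous_diag pN pX.
have d0 : forall i, 0 <= d 0 i.
  apply: psdmx_diagP; have := psdmx_congr (invmx P) pX.
  by rewrite EX !mulmxA -adjmxM mulmxV // adjmx1 mul1mx -mulmxA mulmxV // mulmx1.
have -> : X + N = P^H *m diag_mx (d + const_mx 1) *m P.
  by rewrite raddfD /= diag_const_mx mulmxDr mulmxDl mulmx1 EX EN.
have := pdmx_det_gt0 pN; rewrite EN !det_mulmx det_diag => D0.
rewrite mulrAC ler_pMr //.
rewrite [leLHS](_ : 1 = \prod_(i < n) (1 : C)); last by rewrite big1.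
by apply: ler_prod => i _; rewrite !mxE ler01 lerDr d0.
Qed.

Lemma relative_diag n (A X : 'M[C]_n) : pdmx A -> pdmx X -> psdmx (A - X) ->
  exists (P : 'M[C]_n) (x : 'rV[C]_n),
    [/\ P \in unitmx, A = P^H *m P, X = P^H *m diag_mx x *m P
      & forall i, 0 < x 0 i <= 1].
Proof.
move=> pA pX pAX; have [P [x [uP EA EX]]] := simultaneous_diag pA (pdmxW pX).
exists P, x; split=> // i.
have K (D : 'M[C]_n) : (invmx P)^H *m (P^H *m D *m P) *m invmx P = D.
  by rewrite !mulmxA -adjmxM mulmxV // adjmx1 mul1mx -mulmxA mulmxV // mulmx1.
have uV : invmx P \in unitmx by rewrite unitmx_inv.
have := pdmx_congr_unit pX uV; rewrite EX K => /pdmx_diagP->.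
have := psdmx_congr (invmx P) pAX.
have -> : A - X = P^H *m diag_mx (const_mx 1 - x) *m P.
  by rewrite raddfB /= diag_const_mx mulmxBr mulmxBl mulmx1 EA EX.
by rewrite K => /psdmx_diagP/(_ i); rewrite !mxE subr_ge0.
Qed.

(** Selecting rows and columns is a congruence even when [f] repeats indices. [psdmx_kr] relies on
    this, since [kr_index p] forgets all coordinates of the multi-index but one. *)
Lemma mxsub_congr n k (f : 'I_k -> 'I_n) (M : 'M[C]_n) :
  (colsub f 1%:M)^H *m M *m colsub f 1%:M = mxsub f f M.
Proof.
have -> : (colsub f 1%:M : 'M[C]_(n, k))^H = rowsub f 1%:M.
  by apply/matrixP => i j; rewrite !mxE rmorphMn rmorph1 eq_sym.
rewrite mul_rowsub_mx mul1mx mulmx_colsub mulmx1.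
by rewrite [RHS]mxsubcr.
Qed.

Lemma psdmx_mxsub n k (f : 'I_k -> 'I_n) (M : 'M[C]_n) :
  psdmx M -> psdmx (mxsub f f M).
Proof. by move=> pM; rewrite -mxsub_congr; apply: psdmx_congr. Qed.

Lemma pdmx_mxsub n k (f : 'I_k -> 'I_n) (M : 'M[C]_n) :
  injective f -> pdmx M -> pdmx (mxsub f f M).
Proof.
move=> f_inj pM; rewrite -mxsub_congr; apply: pdmx_congr => // x.
move=> /(congr1 (rowsub f)); rewrite -mul_rowsub_mx.
have -> : rowsub f (colsub f 1%:M : 'M[C]_(n, k)) = 1%:M.
  by apply/matrixP => i j; rewrite !mxE (inj_eq f_inj).
by rewrite mul1mx => ->; apply/colP => i; rewrite !mxE.
Qed.

(** Schur product theorem: a Gram factor [G] of [M] writes the entrywise product as a sum of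
    congruences of [N] by the diagonal matrices of the rows of [G]. *)
Lemma psdmx_hadamard n (M N : 'M[C]_n) :
  psdmx M -> psdmx N -> psdmx (\matrix_(i, j) (M i j * N i j)).
Proof.
move=> /psdmx_gram[G EG] pN.
have -> : \matrix_(i, j) (M i j * N i j) =
    \sum_k (diag_mx (row k G))^H *m N *m diag_mx (row k G).
  apply/matrixP => i j; rewrite !mxE summxE EG mxE mulr_suml; apply: eq_bigr => k _.
  rewrite mul_mx_diag mxE /adjmx map_diag_mx tr_diag_mx mul_diag_mx !mxE.
  by rewrite mulrAC.
by apply: psdmx_sum => k; apply: psdmx_congr.
Qed.

Lemma psdmx_prod n (I : finType) (F : I -> 'M[C]_n) :
  (forall i, psdmx (F i)) -> psdmx (\matrix_(a, b) \prod_i F i a b).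
Proof.
move=> pF; rewrite /index_enum; elim: (Finite.enum _) => [|i r IH].
  (* The empty product is the all-ones matrix, which is a Gram matrix. *)
  suff -> : \matrix_(a, b) \prod_(i <- [::]) F i a b =
      (const_mx 1 : 'rV_n)^H *m 1%:M *m (const_mx 1 : 'rV_n).
    by apply/psdmx_congr/pdmxW/pdmx1.
  apply/matrixP => a b; rewrite !mxE big_nil big_ord1 !mxE big_ord1 !mxE.
  by rewrite rmorph1 !mulr1.
suff <- : \matrix_(a, b) (F i a b * (\matrix_(a, b) \prod_(j <- r) F j a b) a b) =
    \matrix_(a, b) \prod_(j <- i :: r) F j a b by apply: psdmx_hadamard.
by apply/matrixP => a b; rewrite !mxE big_cons.
Qed.

Lemma pdmx_drsub m n (M : 'M[C]_(m + n)) : pdmx M -> pdmx (drsubmx M).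
Proof.
have -> : drsubmx M = mxsub (@rshift m n) (@rshift m n) M.
  by apply/matrixP => i j; rewrite !mxE.
exact/pdmx_mxsub/rshift_inj.
Qed.

Lemma pdmx_ulsub m n (M : 'M[C]_(m + n)) : pdmx M -> pdmx (ulsubmx M).
Proof.
have -> : ulsubmx M = mxsub (@lshift m n) (@lshift m n) M.
  by apply/matrixP => i j; rewrite !mxE.
exact/pdmx_mxsub/lshift_inj.
Qed.

(** Column elimination with [- Z] clears the lower left block of [M] and leaves a corner term [N]
    untouched, so the determinant formula holds for all [N] at once. The two congruences transfer
    positivity to [X] and to the remainder. *)
Lemma schur_complement m n (M : 'M[C]_(m + n)) (d := drsubmx M)
    (Z := invmx d *m dlsubmx M) (X := ulsubmx M - ursubmx M *m Z) :
  M^H = M -> d \in unitmx ->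
  [/\ forall N, \det (M + block_mx N 0 0 0) = \det (X + N) * \det d,
      X = (col_mx 1%:M (- Z))^H *m M *m col_mx 1%:M (- Z),
      M - block_mx X 0 0 0 = (row_mx Z 1%:M)^H *m d *m row_mx Z 1%:M,
      ulsubmx M - X = Z^H *m d *m Z & ursubmx M = Z^H *m d].
Proof.
move=> hM ud.
have dZ : d *m Z = dlsubmx M by rewrite mulKVmx.
have := hM; rewrite -{1 2}[M]submxK adj_block_mx => /eq_block_mx[h1 h2 h3 h4].
have Zd : Z^H *m d = ursubmx M by rewrite -{1}(h4 : d^H = d) -adjmxM dZ h2.
have EX : ulsubmx M - X = Z^H *m d *m Z by rewrite /X opprB addrC subrK Zd.
have MW : M *m col_mx 1%:M (- Z) = col_mx X 0.
  rewrite -{1}[M]submxK mul_block_col !mulmx1 !mulmxN dZ subrr.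
  by rewrite /X.
split=> //.
- move=> N; rewrite -[RHS](@det_ublock _ _ _ _ (ursubmx M)).
  have detQ : \det (block_mx 1%:M 0 (- Z) 1%:M : 'M[C]_(m + n)) = 1.
    by rewrite det_lblock !det1 mulr1.
  rewrite -[LHS]mulr1 -detQ -det_mulmx -{1}[M]submxK add_block_mx !addr0.
  rewrite mulmx_block !mulmx1 !mulmx0 !add0r !mulmxN dZ subrr.
  by rewrite /X addrAC.
- rewrite -mulmxA MW adj_col_mx mul_row_col mulmx0 addr0.
  by rewrite adjmx1 mul1mx.
- rewrite adj_row_mx adjmx1 mul_col_mx mul1mx Zd mul_col_row !mulmx1 dZ.
  rewrite -{1}[M]submxK opp_block_mx add_block_mx !oppr0 !addr0 EX Zd.
  by [].
Qed.

(** The last clause serves the equality case: [X = ulsubmx M] makes [Z^H *m d *m Z] vanish, so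
    [Z = 0] because [d] is definite, and [ursubmx M] is [Z^H *m d]. *)
Lemma pdmx_schur m n (M : 'M[C]_(m + n)) : pdmx M -> exists X : 'M[C]_m,
  [/\ pdmx X, \det M = \det X * \det (drsubmx M),
      psdmx (M - block_mx X 0 0 0), psdmx (ulsubmx M - X)
    & X = ulsubmx M -> ursubmx M = 0].
Proof.
move=> pM; have pd := pdmx_drsub pM.
have [] := schur_complement (pdmx_adj pM) (pdmx_unit pd).
set Z := _ *m dlsubmx M; set X := _ - _ => hdet EX EMX EaX Eb.
exists X; split.
- rewrite EX; apply: pdmx_congr => // x.
  by rewrite mul_col_mx mul1mx => /eqP; rewrite col_mx_eq0 => /andP[/eqP].
- by have := hdet 0; rewrite addr0 block_mx0 addr0.
- by rewrite EMX; apply/psdmx_congr/pdmxW.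
- by rewrite EaX; apply/psdmx_congr/pdmxW.
move=> Xa; suff Z0 : Z = 0 by rewrite Eb Z0 adjmx0 mul0mx.
apply/eqP; rewrite -trmx_eq0; apply/eqP/row_matrixP => i; rewrite row0 -tr_col.
apply: trmx_inj; rewrite trmxK trmx0; apply/eqP; apply: contraT => /(pd.2).
rewrite -[(map_mx _ _)^T]/(adjmx _) colE.
set e := delta_mx i 0; have -> : (Z *m e)^H *m drsubmx M *m (Z *m e) =
    e^H *m (Z^H *m drsubmx M *m Z) *m e by rewrite adjmxM !mulmxA.
by rewrite -EaX Xa subrr mulmx0 mul0mx mxE ltxx.
Qed.

(** The Schur complement of [M] is itself semidefinite, so [det_psd_add_ge] applies to it and
    [N]. *)
Lemma det_add_corner_ge m n (M : 'M[C]_(m + n)) (N : 'M[C]_m) :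
  psdmx M -> pdmx (drsubmx M) -> pdmx N ->
  \det N * \det (drsubmx M) <= \det (M + block_mx N 0 0 0).
Proof.
move=> pM pd pN.
have [hdet EX _ _ _] := schur_complement (psdmx_adj pM) (pdmx_unit pd).
rewrite hdet ler_pM2r ?pdmx_det_gt0 //; apply: det_psd_add_ge => //.
by rewrite EX; apply: psdmx_congr.
Qed.

End Hermitian.

(** * Iterated Kronecker products *)

Section MultiTensor.
Variables (m : nat) (t : 'I_m -> nat).

(** Distributivity when the index type depends on the factor: the dependent functions are exchanged
    for [fprod], to which [big_fprod] applies. *)
Lemma prod_sum_KIdx (R : comPzSemiRingType) (F : forall p, 'I_(t p) -> R) :
  \prod_p \sum_j F p j = \sum_(k : KIdx t) \prod_p F p (k p).
Proof.
rewrite (reindex (@dffun_of_fprod _ (fun p => 'I_(t p)))); last first.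
  exact/onW_bij/dffun_of_fprod_bij.
pose G p := [ffun j : 'I_(t p) => F p j].
transitivity (\sum_(k : fprod (fun p => 'I_(t p))) \prod_(p in 'I_m) G p (k p));
    last first.
  by apply: eq_bigr => k _; apply: eq_bigr => p _; rewrite !ffunE.
rewrite (@big_fprod _ 0 1 *%R +%R _ _ G).
rewrite -(bigA_distr_big_dep (fun p => tagged_with _ p) (fun p => untag 0 (G p))).
apply: eq_bigr => p _; rewrite -(big_tag (fun p => G p)).
by apply: eq_bigr => j _; rewrite ffunE.
Qed.

Lemma card_KIdx_fiber (p : 'I_m) (j : 'I_(t p)) :
  (forall q, 0 < t q)%N -> #|[pred k : KIdx t | k p == j]| = sigma t p.
Proof.
move=> t0; rewrite -sum1_card big_mkcond /=.
(* A 0/1 indicator, constantly 1 for [q != p], turns the count into a sum of products that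
   [prod_sum_KIdx] factors. Values are compared as numbers because [l] and [j] have different
   types. *)
pose c q (l : 'I_(t q)) : nat := (q == p) ==> (l == j :> nat).
transitivity (\sum_(k : KIdx t) \prod_q c q (k q))%N.
  apply: eq_bigr => k _; rewrite (bigD1 p) //= /c eqxx /= big1 ?muln1.
    by rewrite inE -val_eqE; case: eqP.
  by move=> q /negbTE ->.
rewrite -(prod_sum_KIdx c) /sigma [in RHS](bigD1 p) //= mulKn // (bigD1 p) //=.
rewrite (bigD1 j) //= big1 ?addn0 => [|l lj]; last first.
  by rewrite /c eqxx /= (negbTE (lj : (l != j :> nat))).
rewrite /c !eqxx [LHS]mul1r; apply: eq_bigr => q /negbTE qp.
by rewrite qp sum1_card card_ord.
Qed.

Lemma prod_KIdx_coord (R : comPzSemiRingType) (p : 'I_m) (d : 'I_(t p) -> R) :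
  (forall q, 0 < t q)%N ->
  \prod_(k : KIdx t) d (k p) = (\prod_j d j) ^+ sigma t p.
Proof.
move=> t0; rewrite (partition_big (fun k : KIdx t => k p) predT) //= -prodrXl.
apply: eq_bigr => j _; rewrite -(card_KIdx_fiber j t0) -prodr_const.
by apply: eq_big => // k /eqP ->.
Qed.

Lemma prod_enum_val (R : comPzSemiRingType) (T : finType) (f : T -> R) :
  \prod_(a < #|T|) f (enum_val a) = \prod_x f x.
Proof.
rewrite (reindex (@enum_rank T)); last exact/onW_bij/enum_rank_bij.
by apply: eq_bigr => x _; rewrite enum_rankK.
Qed.

Variable C : numClosedFieldType.
Local Notation "M ^H" := (adjmx M) (at level 8, format "M ^H").

Definition tens (B : forall p, 'M[C]_(t p)) : 'M[C]_(#|KIdx t|) :=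
  \matrix_(a, b) \prod_p B p ((enum_val a : KIdx t) p) ((enum_val b : KIdx t) p).

Lemma tensM (A B : forall p, 'M[C]_(t p)) :
  tens A *m tens B = tens (fun p => A p *m B p).
Proof.
apply/matrixP => a b; rewrite !mxE.
under [RHS]eq_bigr => p _ do rewrite mxE.
rewrite prod_sum_KIdx (reindex (@enum_rank (KIdx t))) /=; last first.
  exact/onW_bij/enum_rank_bij.
by apply: eq_bigr => k _; rewrite !mxE enum_rankK -big_split.
Qed.

Lemma tens_diag (d : forall p, 'rV[C]_(t p)) :
  tens (fun p => diag_mx (d p)) =
  diag_mx (\row_a \prod_p d p 0 ((enum_val a : KIdx t) p)).
Proof.
apply/matrixP => a b; rewrite !mxE; have [->|nab] := eqVneq a b.
  by rewrite mulr1n; apply: eq_bigr => p _; rewrite mxE eqxx.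
rewrite mulr0n.
have [p np] : exists p, (enum_val a : KIdx t) p != (enum_val b : KIdx t) p.
  apply/existsP; rewrite -negb_forall; apply: contra nab => /forallP h.
  apply/eqP; apply: enum_val_inj; apply/ffunP => p; apply/eqP/(h p).
by rewrite (bigD1 p) //= mxE (negbTE np) mul0r.
Qed.

Lemma tens1 : tens (fun p => 1%:M) = 1%:M.
Proof.
rewrite (_ : tens _ = tens (fun p => diag_mx (const_mx 1))).
  rewrite tens_diag -diag_const_mx; congr diag_mx; apply/rowP => a.
  by rewrite !mxE big1 // => p _; rewrite mxE.
by apply/matrixP => a b; rewrite !mxE; apply: eq_bigr => p _; rewrite diag_const_mx.
Qed.

Lemma eq_tens (A B : forall p, 'M[C]_(t p)) : (forall p, A p = B p) -> tens A = tens B.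
Proof.
by move=> AB; apply/matrixP => a b; rewrite !mxE; apply: eq_bigr => p _; rewrite AB.
Qed.

Lemma adj_tens (A : forall p, 'M[C]_(t p)) : (tens A)^H = tens (fun p => (A p)^H).
Proof.
apply/matrixP => a b; rewrite !mxE rmorph_prod; apply: eq_bigr => p _.
by rewrite adjmxE.
Qed.

(** Each factor is diagonalised by a unitary matrix; in the product over multi-indices every
    eigenvalue of [A p] occurs [sigma t p] times. *)
Lemma det_tens_pd (A : forall p, 'M[C]_(t p)) : (forall q, 0 < t q)%N ->
  (forall p, pdmx (A p)) -> \det (tens A) = \prod_p \det (A p) ^+ sigma t p.
Proof.
move=> t0 pA.
have /fin_all_exists[U /fin_all_exists[d Ud]] p := psdmx_spectral (pdmxW (pA p)).
have UU p : (U p)^H *m U p = 1%:M by have [/mulmx1C] := Ud p.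
have EA p : A p = (U p)^H *m diag_mx (d p) *m U p by have [] := Ud p.
have detU n (V D : 'M[C]_n) : V^H *m V = 1%:M -> \det (V^H *m D *m V) = \det D.
  by move=> /(congr1 determinant); rewrite !det_mulmx det1 mulrAC => ->; rewrite mul1r.
rewrite (eq_tens EA) -tensM -tensM -adj_tens detU; last first.
  by rewrite adj_tens tensM (eq_tens UU) tens1.
rewrite tens_diag det_diag.
under eq_bigr => a _ do rewrite mxE.
rewrite (prod_enum_val (fun k : KIdx t => \prod_p d p 0 (k p))) exchange_big /=.
apply: eq_bigr => p _; rewrite prod_KIdx_coord //.
by rewrite EA detU // det_diag.
Qed.

(** Both tensors are congruences by [tens P], one of the identity and one of a diagonal matrix of
    products of the [1 - x p]. Their difference is diagonal in the same coordinates, with entries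
    that are positive because [m] is. *)
Lemma tens_gap (A X P : forall p, 'M[C]_(t p)) (x : forall p, 'rV[C]_(t p)) :
  (0 < m)%N ->
  (forall p, [/\ P p \in unitmx, A p = (P p)^H *m P p,
     X p = (P p)^H *m diag_mx (x p) *m P p & forall i, 0 < x p 0 i <= 1]) ->
  pdmx (tens A - tens (fun p => A p - X p)) /\
  \det (tens A - tens (fun p => A p - X p)) =
    \det (tens A) * \prod_(k : KIdx t) (1 - \prod_p (1 - x p 0 (k p))).
Proof.
move=> m0 hP.
have uP p : P p \in unitmx by have [] := hP p.
have EA p : A p = (P p)^H *m P p by have [] := hP p.
have x01 p i : 0 < x p 0 i <= 1 by have [_ _ _] := hP p.
have uT : tens P \in unitmx.
  have := tensM P (fun p => invmx (P p)).
  rewrite [RHS](eq_tens (B := fun=> 1%:M)) => [|p]; last by rewrite /= mulmxV.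
  by rewrite tens1 => /mulmx1_unit[].
pose e : 'rV[C]_(#|KIdx t|) := \row_a (1 - \prod_p (1 - x p 0 ((enum_val a : KIdx t) p))).
have ETA : tens A = (tens P)^H *m tens P by rewrite adj_tens tensM; apply: eq_tens.
have EN : tens A - tens (fun p => A p - X p) = (tens P)^H *m diag_mx e *m tens P.
  have -> : e = const_mx 1 -
      \row_(a < #|KIdx t|) \prod_p (const_mx 1 - x p) 0 ((enum_val a : KIdx t) p).
    apply/rowP => a; rewrite !mxE; congr (_ - _); apply: eq_bigr => p _.
    by rewrite !mxE.
  rewrite raddfB /= diag_const_mx -(tens_diag (fun p => const_mx 1 - x p)).
  rewrite mulmxBr mulmxBl mulmx1 -ETA adj_tens !tensM; congr (_ - _).
  apply: eq_tens => p; rewrite raddfB /= diag_const_mx mulmxBr mulmxBl mulmx1.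
  by have [_ -> ->] := hP p.
split.
  rewrite EN; apply: pdmx_congr_unit => //; apply: pdmx_diag => a; rewrite mxE.
  by apply: some_gt0; rewrite ?card_ord.
rewrite EN ETA !det_mulmx mulrAC det_diag; congr (_ * _).
under eq_bigr => a _ do rewrite mxE.
by rewrite (prod_enum_val (fun k : KIdx t => 1 - \prod_p (1 - x p 0 (k p)))).
Qed.

End MultiTensor.

(** * Khatri-Rao products *)

(** The sizes agree only propositionally, by counting. Once they are identified, [g] is a
    permutation whose sign enters twice. *)
Lemma det_mxsub_bij (R : comNzRingType) n k (g : 'I_n -> 'I_k) (M : 'M[R]_k) :
  bijective g -> \det (mxsub g g M) = \det M.
Proof.
move=> bg; have E : n = k by have := bij_eq_card bg; rewrite !card_ord.
case: k / E in g bg M *.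
pose s := perm (bij_inj bg).
have -> : mxsub g g M = row_perm s (col_perm s M).
  by apply/matrixP => i j; rewrite !mxE !permE.
rewrite row_permE col_permE !det_mulmx !det_perm mulrCA odd_permV.
by rewrite -signr_addb addbb mulr1.
Qed.

Section KhatriRao.
Variables (C : numClosedFieldType) (m : nat) (t : 'I_m -> nat).
Local Notation N := #|KIdx t|.

(* [kr] reindexes [khatri_rao] so that its size [s.+1 * N] is convertible to
   [N + s * N]: the first block can then be split off by the block operations. *)
Definition kr_index s p (a : 'I_(s * N)) : 'I_(s * t p) :=
  blk (mxtens_unindex a).1 ((enum_val (mxtens_unindex a).2 : KIdx t) p).

Definition kr s (A : forall p, 'M[C]_(s * t p)) : 'M[C]_(s * N) :=
  \matrix_(a, b) \prod_p A p (kr_index p a) (kr_index p b).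

Lemma det_khatri_rao s (A : forall p, 'M[C]_(s * t p)) :
  \det (khatri_rao A) = \det (kr A).
Proof.
pose g (a : 'I_(#|{: 'I_s * KIdx t}|)) : 'I_(s * N) :=
  mxtens_index ((enum_val a).1, enum_rank (enum_val a).2).
have bg : bijective g.
  exists (fun b => enum_rank ((mxtens_unindex b).1,
                   enum_val (mxtens_unindex b).2 : KIdx t)) => a.
    by rewrite /g mxtens_indexK /= enum_rankK -[RHS]enum_valK; case: (enum_val a).
  by case: (mxtens_indexP a) => i k; rewrite /g mxtens_indexK enum_rankK /= enum_valK.
rewrite -(det_mxsub_bij _ bg); congr (\det _); apply/matrixP => a b.
rewrite !mxE; apply: eq_bigr => p _.
by rewrite /kr_index /g !mxtens_indexK /= !enum_rankK.
Qed.

Lemma psdmx_kr s (A : forall p, 'M[C]_(s * t p)) :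
  (forall p, psdmx (A p)) -> psdmx (kr A).
Proof.
move=> pA; have := psdmx_prod (fun p => psdmx_mxsub (@kr_index s p) (pA p)).
set K := \matrix_(a, b) _; suff -> : kr A = K by [].
by apply/matrixP => a b; rewrite !mxE; apply: eq_bigr => p _; rewrite mxE.
Qed.

Lemma kr_index_lshift s p (a : 'I_N) :
  kr_index p (lshift (s * N) a : 'I_(s.+1 * N)) =
  lshift (s * t p) ((enum_val a : KIdx t) p).
Proof.
have -> : lshift (s * N) a = mxtens_index (ord0 : 'I_s.+1, a) by apply: val_inj.
by rewrite /kr_index mxtens_indexK; apply: val_inj.
Qed.

Lemma kr_index_rshift s p (b : 'I_(s * N)) :
  kr_index p (rshift N b : 'I_(s.+1 * N)) = rshift (t p) (kr_index p b).
Proof.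
case: (mxtens_indexP b) => i k; rewrite /kr_index mxtens_indexK.
have -> : rshift N (mxtens_index (i, k)) = mxtens_index (lift ord0 i, k).
  by apply: val_inj; rewrite /= /bump /= add1n mulSn addnA.
rewrite mxtens_indexK; apply: val_inj.
by rewrite /= /bump /= add1n mulSn addnA.
Qed.

(** Each [X p] lives in the first diagonal block, so outside it no factor changes. Inside, the
    tensor of the corners becomes the tensor of the differences, and the last summand restores
    it. *)
Lemma kr_corner s (A X : forall p, 'M[C]_(s.+1 * t p)) (Y : forall p, 'M[C]_(t p)) :
  (forall p, X p = block_mx (Y p) 0 0 0 :> 'M_(t p + s * t p)) ->
  kr A = kr (fun p => A p - X p) +
    (block_mx (tens (fun p => ulsubmx (A p : 'M_(t p + s * t p)))
         - tens (fun p => ulsubmx (A p : 'M_(t p + s * t p)) - Y p)) 0 0 0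
      : 'M[C]_(N + s * N)).
Proof.
move=> EX; apply/matrixP => a b.
have corner0 p (i j : 'I_(t p + s * t p)) :
    (A p - X p : 'M_(t p + s * t p)) i j =
    A p i j - (block_mx (Y p) 0 0 0 : 'M_(t p + s * t p)) i j.
  by rewrite -EX !mxE.
rewrite [RHS]mxE [LHS]mxE [kr _ a b]mxE; under [X in _ = X + _]eq_bigr => p _ do
  rewrite corner0.
case: (@split_ordP N (s * N) a) => a' ->; case: (@split_ordP N (s * N) b) => b' ->.
- rewrite block_mxEul !mxE.
  under [LHS]eq_bigr => p _ do rewrite !kr_index_lshift.
  under [X in _ = X + _]eq_bigr => p _ do rewrite !kr_index_lshift block_mxEul.
  under [X in _ + (_ - X)]eq_bigr => p _ do rewrite !mxE.
  under [X in _ + (X - _)]eq_bigr => p _ do rewrite !mxE.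
  by rewrite addrC subrK.
- rewrite block_mxEur mxE addr0; apply: eq_bigr => p _.
  by rewrite kr_index_lshift kr_index_rshift block_mxEur mxE subr0.
- rewrite block_mxEdl mxE addr0; apply: eq_bigr => p _.
  by rewrite kr_index_lshift kr_index_rshift block_mxEdl mxE subr0.
- rewrite block_mxEdr mxE addr0; apply: eq_bigr => p _.
  by rewrite !kr_index_rshift block_mxEdr mxE subr0.
Qed.

Lemma drsub_kr s (A : forall p, 'M[C]_(s.+1 * t p)) :
  drsubmx (kr A : 'M[C]_(N + s * N)) =
  kr (fun p => drsubmx (A p : 'M[C]_(t p + s * t p))).
Proof.
apply/matrixP => a b; rewrite !mxE; apply: eq_bigr => p _.
by rewrite !kr_index_rshift !mxE.
Qed.

Lemma kr_eq s (A B : forall p, 'M[C]_(s * t p)) : (forall p, A p = B p) -> kr A = kr B.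
Proof.
by move=> AB; apply/matrixP => a b; rewrite !mxE; apply: eq_bigr => p _; rewrite AB.
Qed.

Lemma blk0 s q (k : 'I_q) : blk (ord0 : 'I_s.+1) k = lshift (s * q) k.
Proof. exact: val_inj. Qed.

Lemma blk_lift s q (i : 'I_s) (k : 'I_q) : blk (lift ord0 i) k = rshift q (blk i k).
Proof. by apply: val_inj; rewrite /= /bump /= add1n mulSn addnA. Qed.

Lemma block_of00 s q (M : 'M[C]_(s.+1 * q)) :
  block_of M ord0 ord0 = ulsubmx (M : 'M_(q + s * q)).
Proof. by apply/matrixP => i j; rewrite !mxE !blk0. Qed.

Lemma block_of0l s q (M : 'M[C]_(s.+1 * q)) j :
  ursubmx (M : 'M_(q + s * q)) = 0 -> block_of M ord0 (lift ord0 j) = 0.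
Proof.
move=> /matrixP M0; apply/matrixP => k l; have := M0 k (blk j l).
by rewrite !mxE blk0 blk_lift.
Qed.

Lemma block_of_lift s q (M : 'M[C]_(s.+1 * q)) i j :
  block_of M (lift ord0 i) (lift ord0 j) = block_of (drsubmx (M : 'M_(q + s * q))) i j.
Proof. by apply/matrixP => k l; rewrite !mxE !blk_lift. Qed.

Lemma blk_inj s q (i : 'I_s) : injective (@blk s q i).
Proof. by move=> k l /(congr1 val) /= /addnI/val_inj. Qed.

Lemma pdmx_block_of s q (M : 'M[C]_(s * q)) i : pdmx M -> pdmx (block_of M i i).
Proof.
have -> : block_of M i i = mxsub (@blk s q i) (@blk s q i) M.
  by apply/matrixP => k l; rewrite !mxE.
exact/pdmx_mxsub/blk_inj.
Qed.

(** The induction continues with the original trailing submatrix of [A p], not with a Schur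
    complement, so the diagonal blocks remain those of [A p]. The family [x p i] holds the relative
    eigenvalues at stage [i]; the last clause is kept for the equality case. *)
Theorem kr_det_lower_bound s (A : forall p, 'M[C]_(s * t p)) :
  (0 < m)%N -> (forall p, 0 < t p)%N -> (forall p, pdmx (A p)) ->
  exists x : forall p, 'I_s -> 'I_(t p) -> C,
  [/\ forall p i j, 0 < x p i j <= 1,
      forall p, \det (A p) = \prod_i (\det (block_of (A p) i i) * \prod_j x p i j),
      \prod_i ((\prod_p \det (block_of (A p) i i) ^+ sigma t p) *
               \prod_(k : KIdx t) (1 - \prod_p (1 - x p i (k p)))) <= \det (kr A)
    & forall p (i i' : 'I_s), (forall j, x p i j = 1) -> (i < i')%N ->
        block_of (A p) i i' = 0].
Proof.
move=> m0 t0; elim: s A => [|s IHs] A pA.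
  exists (fun p i j => 1); split=> [p []|p| |p []] //.
    by rewrite big_ord0 det_mx00.
  by rewrite big_ord0 det_mx00.
pose A' p : 'M[C]_(t p + s * t p) := A p.
have pA' p : pdmx (A' p) := pA p.
have /fin_all_exists[X hX] p := pdmx_schur (pA' p).
have /fin_all_exists[P /fin_all_exists[x0 hP]] p :
  exists (Q : 'M[C]_(t p)) (y : 'rV[C]_(t p)),
    [/\ Q \in unitmx, ulsubmx (A' p) = adjmx Q *m Q, X p = adjmx Q *m diag_mx y *m Q
      & forall i, 0 < y 0 i <= 1].
  have [pX _ _ pAX _] := hX p.
  exact: relative_diag (pdmx_ulsub (pA' p)) pX pAX.
have [p|x [x01 detx lex blx]] := IHs (fun p => drsubmx (A' p)).
  exact: pdmx_drsub.
exists (fun p i => if unlift ord0 i is Some i' then x p i' else fun j => x0 p 0 j).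
have x001 p j : 0 < x0 p 0 j <= 1 by have [_ _ _] := hP p.
have detX p : \det (X p) = \det (ulsubmx (A' p)) * \prod_j x0 p 0 j.
  by have [_ -> -> _] := hP p; rewrite !det_mulmx det_diag mulrAC.
have [pN detN] := tens_gap m0 hP.
split.
- by move=> p i j; case: unliftP.
- move=> p; rewrite big_ord_recl unlift_none block_of00 -/(A' p) -detX.
  have [_ -> _ _ _] := hX p; rewrite detx; congr (_ * _); apply: eq_bigr => i _.
  by rewrite liftK block_of_lift.
- rewrite big_ord_recl unlift_none.
  under eq_bigr => p _ do rewrite block_of00 -/(A' p).
  under [X in _ * X <= _]eq_bigr => i _.
    under eq_bigr => p _ do rewrite block_of_lift -/(A' p).
    rewrite liftK; over.
  rewrite -det_tens_pd // => [|p]; last exact: pdmx_ulsub.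
  rewrite -detN.
  pose Z p : 'M[C]_(s.+1 * t p) := (block_mx (X p) 0 0 0 : 'M[C]_(t p + s * t p)).
  rewrite (kr_corner A (X := Z) (Y := X)) //.
  have dK : drsubmx (kr (fun p => A p - Z p) : 'M[C]_(N + s * N)) =
      kr (fun p => drsubmx (A' p)).
    rewrite drsub_kr; apply: kr_eq => p.
    rewrite -[A p - Z p]/(A' p - block_mx (X p) 0 0 0) -{1}[A' p]submxK.
    by rewrite opp_block_mx add_block_mx block_mxKdr oppr0 addr0.
  (* The inductive lower bound is positive; together with semidefiniteness this makes the trailing
     Khatri-Rao product positive definite. *)
  have D0 : 0 < \det (kr (fun p => drsubmx (A' p))).
    apply: lt_le_trans lex; apply: prodr_gt0 => i _; apply: mulr_gt0.
    apply: prodr_gt0 => p _; apply: exprn_gt0.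
      by apply/pdmx_det_gt0/pdmx_block_of/pdmx_drsub.
    apply: prodr_gt0 => k _; apply: some_gt0; rewrite ?card_ord // => p; exact: x01.
  have pK : psdmx (kr (fun p => A p - Z p)).
    by apply: psdmx_kr => p; have [] := hX p.
  have pD : pdmx (drsubmx (kr (fun p => A p - Z p) : 'M[C]_(N + s * N))).
    rewrite dK; apply: psdmx_unit_pd; last by rewrite gt_eqF.
    by apply: psdmx_kr => p; apply/pdmxW/pdmx_drsub.
  apply: le_trans (det_add_corner_ge pK pD pN).
  by rewrite dK ler_pM2l ?pdmx_det_gt0.
- move=> p i i'; case: (unliftP ord0 i) => [j|] ->.
    case: (unliftP ord0 i') => [j'|] -> // h.
    rewrite block_of_lift /= /bump /= !add1n ltnS => jj.
    by apply: blx.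
  (* If all relative eigenvalues are 1, then [X p] is the corner of [A p], and [pdmx_schur] makes
     the upper right part zero. *)
  move=> h; case: (unliftP ord0 i') => [j'|] -> // _; apply: block_of0l.
  have [_ _ _ _] := hX p; apply; have [_ -> -> _] := hP p.
  have -> : x0 p = const_mx 1 by apply/rowP => j; rewrite h mxE.
  by rewrite diag_const_mx mulmx1.
Qed.

End KhatriRao.

(** * Arrowhead matrices and the equality cases *)

(** A permutation other than the identity moves at least two points, hence some point other than
    [k], and so picks up a zero factor. *)
Lemma det_single_row (R : comNzRingType) n (G : 'M[R]_n) (k : 'I_n) :
  (forall i j, i != j -> i != k -> G i j = 0) -> \det G = \prod_i G i i.
Proof.
move=> G0; rewrite /determinant (bigD1 (1%g : 'S_n)) //= odd_perm1 expr0 mul1r.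
rewrite [X in _ + X]big1 ?addr0 => [|s s1].
  by apply: eq_bigr => i _; rewrite perm1.
have [i ik si] : exists2 i, i != k & i != s i.
  apply/exists_inP; apply: contraR s1 => /exists_inPn h.
  have sE i : i != k -> s i = i by move=> /h; rewrite negbK => /eqP.
  apply/eqP/permP => i; rewrite perm1; have [->|/sE//] := eqVneq i k.
  apply/eqP; apply: contraT => nk.
  by have sk := perm_inj (sE _ nk); rewrite sk eqxx in nk.
by rewrite (bigD1 i) //= G0 // mul0r mulr0.
Qed.

Lemma det_arrowhead (F : fieldType) n (a : 'M[F]_n) (k : 'I_n) :
  (forall i j, i != j -> i != k -> j != k -> a i j = 0) ->
  (forall i, i != k -> a i i != 0) ->
  \det a = (a k k - \sum_(j | j != k) a k j * a j k / a j j) * \prod_(j | j != k) a j j.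
Proof.
move=> a0 d0.
(* Right multiplication by [E] subtracts from column [k] the multiples of the other columns that
   clear it outside row [k]. *)
pose E : 'M[F]_n :=
  \matrix_(i, j) if (j == k) && (i != k) then - a i k / a i i else (i == j)%:R.
have detE : \det E = 1.
  rewrite -det_tr (det_single_row (k := k)) => [|i j ij ik].
    by rewrite big1 // => i _; rewrite !mxE eqxx; case: eqP.
  by rewrite !mxE (negbTE ik) /= eq_sym (negbTE ij).
have GE i j : j != k -> (a *m E) i j = a i j.
  move=> jk; rewrite mxE (bigD1 j) //= !mxE (negbTE jk) /= eqxx mulr1 big1 ?addr0 //.
  by move=> l lj; rewrite mxE (negbTE jk) /= (negbTE lj) mulr0.
have GkE i : (a *m E) i k = a i k - \sum_(j | j != k) a i j * a j k / a j j.
  rewrite mxE (bigD1 k) //= mxE !eqxx /= mulr1; congr (_ + _).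
  rewrite -sumrN; apply: eq_bigr => j jk; rewrite mxE eqxx jk /=.
  by rewrite mulNr mulrN mulrA.
have -> : \det a = \det (a *m E) by rewrite det_mulmx detE mulr1.
rewrite (det_single_row (k := k)).
  rewrite (bigD1 k) //= GkE; congr (_ * _); apply: eq_bigr => j jk.
  by rewrite GE.
move=> i j ij ik; have [->|jk] := eqVneq j k; last by rewrite GE // a0.
rewrite GkE (bigD1 i) //= big1 ?addr0 => [|l /andP[lk li]].
  by rewrite mulrAC mulfV ?d0 // mul1r subrr.
by rewrite a0 ?mul0r // eq_sym.
Qed.

Section CrossTerms.
Variable R : numDomainType.

(** In the expansion of the product of sums over all functions into [J], the constant functions give
    the left side, so by nonnegativity every other term vanishes. *)
Lemma sum_prod_eq_prod_sum (m : nat) (J : finType) (c : 'I_m -> J -> R) :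
  (1 < m)%N -> (forall p j, 0 <= c p j) ->
  \sum_j \prod_p c p j = \prod_p \sum_j c p j ->
  (exists p, forall j, c p j = 0) \/
  (exists j, forall p l, l != j -> c p l = 0).
Proof.
move=> m1 c0; rewrite bigA_distr_bigA => E.
pose K (j : J) : {ffun 'I_m -> J} := [ffun=> j].
pose F (f : {ffun 'I_m -> J}) := \prod_p c p (f p).
have F0 f : 0 <= F f by apply: prodr_ge0.
pose p0 : 'I_m := Ordinal (ltnW m1).
have Kinj : injective K by move=> j l /ffunP/(_ p0); rewrite !ffunE.
have Fnc f : f \notin [set K j | j in J] -> F f = 0.
  move=> nf; move: E; rewrite [RHS](bigID (fun f => f \in [set K j | j in J])) /=.
  rewrite big_imset /=; last by move=> ? ? _ _; apply: Kinj.
  under [X in _ = X + _]eq_bigr => j _ do under eq_bigr => p _ do rewrite ffunE.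
  rewrite -[X in X = _]addr0 => /addrI /esym Enc.
  exact: (psumr_eq0P (fun f _ => F0 f) Enc).
case: (pickP (fun p => [forall j, c p j == 0])) => [p /forallP h|N0].
  by left; exists p => j; apply/eqP.
have /fin_all_exists[f hf] p : exists j, c p j != 0.
  by apply/existsP; rewrite -negb_forall N0.
have : F (finfun f) != 0.
  by apply/prodf_neq0 => p _; rewrite ffunE.
move=> Ff; have : finfun f \in [set K j | j in J].
  by apply: contraR Ff => /Fnc ->.
case/imsetP=> j _ fj; right; exists j => p l lj.
have fE q : f q = j by have /ffunP/(_ q) := fj; rewrite !ffunE.
apply/eqP; apply: contraT => cl.
(* Changing the choice at [p] alone gives a nonzero term, yet [g] is not constant because there is a
   factor other than [p]. *)
pose g : {ffun 'I_m -> J} := [ffun q => if q == p then l else j].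
have : F g != 0.
  apply/prodf_neq0 => q _; rewrite ffunE; have [->|_] := eqVneq q p; first exact: cl.
  by rewrite -(fE q).
have /Fnc -> : g \notin [set K j | j in J]; last by rewrite eqxx.
apply/imsetP => -[l' _ gl].
have [q qp] : exists q : 'I_m, q != p.
  have /card_gt0P[q] : (0 < #|predC1 p|)%N by rewrite cardC1 card_ord -subn1 subn_gt0.
  by rewrite !inE => qp; exists q.
move: lj; have /ffunP h := gl.
by have := h p; have := h q; rewrite !ffunE eqxx (negbTE qp) => -> ->; rewrite eqxx.
Qed.

End CrossTerms.

(** * The bound and the first consequences of equality, definite case *)

Section PositiveDefinite.
Variables (C : numClosedFieldType) (m : nat) (t : 'I_m -> nat).
Hypothesis m0 : (0 < m)%N.
Hypothesis t0 : forall p, (0 < t p)%N.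

Definition diag_dets s (A : forall p, 'M[C]_(s * t p)) p : C :=
  \prod_(i < s) \det (block_of (A p) i i) ^+ sigma t p.

Definition oppenheim_bound s (A : forall p, 'M[C]_(s * t p)) : C :=
  \prod_p diag_dets A p - \prod_p (diag_dets A p - \det (A p) ^+ sigma t p).

Lemma KIdx_through p (j : 'I_(t p)) : exists k : KIdx t, k p = j.
Proof.
exists (finfun (dfwith (fun q => Ordinal (t0 q)) j)).
by rewrite ffunE dfwith_in.
Qed.

Lemma block_of_adj s q (M : 'M[C]_(s * q)) i j :
  adjmx M = M -> block_of M j i = adjmx (block_of M i j).
Proof. by move=> hM; apply/matrixP => k l; rewrite !mxE -{1}hM adjmxE. Qed.

Lemma block_diag_half s q (M : 'M[C]_(s * q)) : adjmx M = M ->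
  (forall i j : 'I_s, (i < j)%N -> block_of M i j = 0) -> block_diag M.
Proof.
move=> hM M0 i j; rewrite neq_ltn => /orP[/M0//|ji].
by rewrite (block_of_adj _ _ hM) M0 // adjmx0.
Qed.

Section Chain.
Variables (s : nat) (A : forall p, 'M[C]_(s * t p)).
Hypothesis pA : forall p, pdmx (A p).

(** [prod_some_ge] is applied with pairs of a block and a multi-index as trials and the factors [p]
    as events. When the determinant meets the bound, the chain of inequalities collapses and leaves
    equality in [prod_some_ge]. *)
Lemma oppenheim_chain :
  exists x : forall p, 'I_s -> 'I_(t p) -> C,
  [/\ forall p i j, 0 < x p i j <= 1,
      forall p (i i' : 'I_s), (forall j, x p i j = 1) -> (i < i')%N ->
        block_of (A p) i i' = 0,
      oppenheim_bound A <= \det (kr A)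
    & \det (kr A) = oppenheim_bound A ->
      \prod_(y : 'I_s * KIdx t) (1 - \prod_p (1 - x p y.1 (y.2 p))) =
      1 - \prod_p (1 - \prod_(y : 'I_s * KIdx t) x p y.1 (y.2 p))].
Proof.
have [x [x01 detx lex blx]] := kr_det_lower_bound m0 t0 pA.
have D0 p : 0 < diag_dets A p.
  by apply: prodr_gt0 => i _; apply/exprn_gt0/pdmx_det_gt0/pdmx_block_of.
have DD0 : 0 < \prod_p diag_dets A p by apply: prodr_gt0.
(* [r p] is the ratio of [\det (A p) ^+ sigma t p] to [diag_dets A p], since each relative
   eigenvalue occurs [sigma t p] times among the multi-indices. *)
pose r p := \prod_(y : 'I_s * KIdx t) x p y.1 (y.2 p).
have rE p : \det (A p) ^+ sigma t p = diag_dets A p * r p.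
  rewrite detx -prodrXl /r -(pair_bigA _ (fun i (k : KIdx t) => x p i (k p))).
  rewrite /diag_dets -big_split /=; apply: eq_bigr => i _.
  by rewrite exprMn (prod_KIdx_coord (x p i)).
have bE : oppenheim_bound A = \prod_p diag_dets A p * (1 - \prod_p (1 - r p)).
  rewrite /oppenheim_bound mulrBr mulr1 -big_split; congr (_ - _).
  by apply: eq_bigr => p _ /=; rewrite rE mulrBr mulr1.
move: lex; rewrite big_split /= exchange_big -/(diag_dets A) /=.
rewrite (pair_bigA _ (fun i (k : KIdx t) => 1 - \prod_p (1 - x p i (k p)))) /= => lex.
have xW (y : 'I_s * KIdx t) p : 0 <= x p y.1 (y.2 p) <= 1.
  by have /andP[/ltW-> ->] := x01 p y.1 (y.2 p).
have leh := prod_some_ge predT xW.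
have leb : oppenheim_bound A <= \prod_p diag_dets A p *
    \prod_(y : 'I_s * KIdx t) (1 - \prod_p (1 - x p y.1 (y.2 p))).
  by rewrite bE ler_pM2l.
exists x; split=> //; first exact: le_trans leb lex.
move=> E; apply: le_anti; rewrite leh andbT.
by move: lex; rewrite E bE ler_pM2l.
Qed.

Theorem pd_oppenheim : oppenheim_bound A <= \det (kr A).
Proof. by have [x []] := oppenheim_chain. Qed.

(** By [prod_some_eq], either some [p] has only relative eigenvalues 1, or at most one trial
    [(k, f)] is nontrivial; in the latter case [k] becomes the hub of an arrowhead. *)
Lemma pd_oppenheim_eq : (1 < m)%N -> \det (kr A) = oppenheim_bound A ->
  (exists p, block_diag (A p)) \/
  (forall p, t p = 1%N) /\
  (exists k : 'I_s, forall p (i j : 'I_s),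
      (i < j)%N -> i != k -> block_of (A p) i j = 0).
Proof.
move=> m1 E; have [x [x01 blx _ /(_ E) Eh]] := oppenheim_chain.
have bd p : (forall y : 'I_s * KIdx t, x p y.1 (y.2 p) = 1) -> block_diag (A p).
  move=> x1; apply: block_diag_half; first exact: pdmx_adj.
  move=> i j; apply: blx => l; have [k <-] := KIdx_through l.
  exact: (x1 (i, k)).
have := @prod_some_eq _ ('I_s * KIdx t)%type 'I_m (fun y p => x p y.1 (y.2 p)).
rewrite card_ord; case=> //; first by case=> p /bd; left; exists p.
case=> -[k f] hk.
case: (pickP (fun p => x p k (f p) == 1)) => [p /eqP xp|N1].
  left; exists p; apply: bd => y; have [->//|] := eqVneq y (k, f).
  exact: hk.
right; have t1 q : t q = 1%N.
  apply/eqP; rewrite eqn_leq t0 andbT leqNgt; apply/negP => tq.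
  have [j jf] : exists j, j != f q.
    have /card_gt0P[j] : (0 < #|predC1 (f q)|)%N.
      by rewrite cardC1 card_ord -subn1 subn_gt0.
    by rewrite !inE => jf; exists j.
  have [p pq] : exists p : 'I_m, p != q.
    have /card_gt0P[p] : (0 < #|predC1 q|)%N by rewrite cardC1 card_ord -subn1 subn_gt0.
    by rewrite !inE => pq; exists p.
  (* Altering [f] at [q] gives another trial that still agrees with [f] at [p], so the eigenvalue of
     [p] at [(k, f)] would be 1. *)
  pose g : KIdx t := finfun (dfwith f j).
  have gf : (k, g) != (k, f).
    apply: contra jf => /eqP[] /(congr1 (fun h : KIdx t => h q)).
    by rewrite ffunE dfwith_in => ->.
  have := hk _ p gf; rewrite /= ffunE dfwith_out 1?eq_sym // => /eqP.
  by rewrite N1.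
split=> //; exists k => p i j ij ik; apply: blx (ij) => l.
have [h <-] := KIdx_through l; apply: (hk (i, h)).
by apply: contra ik => /eqP[->].
Qed.

End Chain.

End PositiveDefinite.

Lemma card_KIdx m (t : 'I_m -> nat) : #|KIdx t| = (\prod_p t p)%N.
Proof.
rewrite -sum1_card; transitivity (\sum_(k : KIdx t) \prod_(p < m) 1%N)%N.
  by apply: eq_bigr => k _; rewrite big1.
rewrite -(prod_sum_KIdx (fun p (_ : 'I_(t p)) => 1%N)).
by apply: eq_bigr => p _; rewrite sum1_card card_ord.
Qed.

(** * Blocks of size one *)

Section ScalarBlocks.
Variables (C : numClosedFieldType) (m : nat) (t : 'I_m -> nat).
Hypothesis m0 : (0 < m)%N.
Hypothesis t1 : forall p, t p = 1%N.
Variables (s : nat) (A : forall p, 'M[C]_(s * t p)).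
Hypothesis pA : forall p, pdmx (A p).

Let t0 p : (0 < t p)%N. Proof. by rewrite t1. Qed.

Let o p : 'I_(t p) := Ordinal (t0 p).

Lemma scalar_pos p (k : 'I_(t p)) : k = o p.
Proof.
apply: val_inj; apply/eqP; rewrite -leqn0 -ltnS -[X in (_ < X)%N](t1 p).
exact: ltn_ord.
Qed.

(** As [t p = 1] is only a propositional equality, [A p] is read as a matrix of size [s] through the
    unique position [o p]. *)
Definition scalar_mx_of p : 'M[C]_s := \matrix_(i, j) A p (blk i (o p)) (blk j (o p)).
Local Notation a := scalar_mx_of.

Lemma scalar_entry p i j (k l : 'I_(t p)) : A p (blk i k) (blk j l) = a p i j.
Proof. by rewrite mxE [k]scalar_pos [l]scalar_pos. Qed.

Lemma scalar_sigma p : sigma t p = 1%N.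
Proof. by rewrite /sigma t1 divn1 big1. Qed.

Lemma scalar_det p : \det (A p) = \det (a p).
Proof.
have bg : bijective (fun i : 'I_s => blk i (o p)).
  apply: inj_card_bij => [i j /(congr1 val) /= /addIn /eqP|].
    by rewrite eqn_pmul2r // => /eqP /val_inj.
  by rewrite !card_ord t1 muln1.
by rewrite -(det_mxsub_bij _ bg).
Qed.

Lemma scalar_det_block p i : \det (block_of (A p) i i) = a p i i.
Proof.
have bg : bijective (fun _ : 'I_1 => o p).
  by apply: inj_card_bij => [i' j' _|]; rewrite ?card_ord ?t1 // !ord1.
by rewrite -(det_mxsub_bij _ bg) det_mx11 !mxE.
Qed.

Lemma scalar_det_kr : \det (kr A) = \det (\matrix_(i, j) \prod_p a p i j).
Proof.
pose k0 : KIdx t := finfun o.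
have bg : bijective (fun i : 'I_s => mxtens_index (i, enum_rank k0)).
  apply: inj_card_bij => [i j|].
    by move=> /(can_inj (@mxtens_indexK _ _)) [].
  by rewrite !card_ord card_KIdx big1 ?muln1.
rewrite -(det_mxsub_bij _ bg); congr (\det _); apply/matrixP => i j.
rewrite !mxE; apply: eq_bigr => p _.
by rewrite /kr_index !mxtens_indexK /= enum_rankK scalar_entry.
Qed.

Lemma scalar_conj p i j : a p j i = (a p i j)^*.
Proof. by rewrite !mxE -{1}(pdmx_adj (pA p)) adjmxE. Qed.

Lemma scalar_diag_gt0 p i : 0 < a p i i.
Proof. by rewrite -scalar_det_block; apply/pdmx_det_gt0/pdmx_block_of. Qed.

Lemma scalar_diag_dets p : diag_dets A p = \prod_i a p i i.
Proof. by apply: eq_bigr => i _; rewrite scalar_sigma scalar_det_block. Qed.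

(** The contribution |a_kj|^2 / a_jj of index [j] to the arrowhead determinant. The value 0 at the
    hub lets sums range over all of ['I_s]. *)
Definition spoke (k : 'I_s) p j : C :=
  if j == k then 0 else a p k j * a p j k / a p j j.

Lemma spoke_ge0 k p j : 0 <= spoke k p j.
Proof.
rewrite /spoke; case: ifP => // _; rewrite (scalar_conj _ k j).
by rewrite divr_ge0 ?mul_conjC_ge0 // ltW // scalar_diag_gt0.
Qed.

Lemma spoke_eq0 k p j : spoke k p j = 0 -> j != k -> a p k j = 0.
Proof.
move=> + jk; rewrite /spoke (negbTE jk) => /eqP.
rewrite mulf_eq0 invr_eq0 (gt_eqF (scalar_diag_gt0 p j)) orbF.
by rewrite (scalar_conj _ k j) mul_conjC_eq0 => /eqP.
Qed.

(** The Khatri-Rao product is now an entrywise product, again an arrowhead, and its spokes are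
    products of spokes. By [det_arrowhead] the two sides share the factor [\prod_p Q p] and the term
    [\prod_p a p k k]. *)
Lemma arrowhead_eq k :
  (forall p i j, i != j -> i != k -> j != k -> a p i j = 0) ->
  \det (kr A) = oppenheim_bound A <->
  \sum_j \prod_p spoke k p j = \prod_p \sum_j spoke k p j.
Proof.
move=> a0.
have dp p i : a p i i != 0 by rewrite gt_eqF ?scalar_diag_gt0.
pose p0 : 'I_m := Ordinal m0.
pose Q p := \prod_(j | j != k) a p j j.
have QQ0 : \prod_p Q p != 0.
  by apply/prodf_neq0 => p _; apply/prodf_neq0 => j _.
have spE p : \sum_(j | j != k) a p k j * a p j k / a p j j = \sum_j spoke k p j.
  rewrite [RHS](bigD1 k) //= {1}/spoke eqxx add0r.
  by apply: eq_bigr => j jk; rewrite /spoke (negbTE jk).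
have dA p : \det (A p) = (a p k k - \sum_j spoke k p j) * Q p.
  by rewrite scalar_det (det_arrowhead (k := k)) ?spE // => i j; apply: a0.
have dK : \det (kr A) =
    (\prod_p a p k k - \sum_j \prod_p spoke k p j) * \prod_p Q p.
  rewrite scalar_det_kr (det_arrowhead (k := k)); first last.
  - by move=> i _; rewrite mxE; apply/prodf_neq0 => p _.
  - by move=> i j ij ik jk; rewrite mxE (bigD1 p0) //= a0 // mul0r.
  rewrite mxE; congr ((_ - _) * _).
    rewrite [RHS](bigD1 k) //= (bigD1 p0) //= {1}/spoke eqxx mul0r add0r.
    apply: eq_bigr => j jk; rewrite !mxE -big_split -prodfV -big_split /=.
    by apply: eq_bigr => p _; rewrite /spoke (negbTE jk).
  rewrite [RHS]exchange_big /=.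
  by apply: eq_bigr => j _; rewrite mxE.
have bE : oppenheim_bound A =
    (\prod_p a p k k - \prod_p \sum_j spoke k p j) * \prod_p Q p.
  rewrite /oppenheim_bound mulrBl -!big_split /=.
  congr (_ - _); apply: eq_bigr => p _; rewrite scalar_diag_dets (bigD1 k) //=.
  by rewrite scalar_sigma expr1 dA -/(Q p); ring.
rewrite dK bE; split=> [/(mulIf QQ0)|->] //.
by move/addrI/oppr_inj.
Qed.

Lemma arrowhead_eq_cases k : (1 < m)%N ->
  (forall p i j, i != j -> i != k -> j != k -> a p i j = 0) ->
  \det (kr A) = oppenheim_bound A ->
  (exists p, block_diag (A p)) \/
  (exists i j : 'I_s, i != j /\ forall p i' j', i' != j' ->
     ~ ((i' == i) && (j' == j) || (i' == j) && (j' == i)) -> a p i' j' = 0).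
Proof.
move=> m1 a0 /(arrowhead_eq a0) E.
have bd p : (forall j, spoke k p j = 0) -> block_diag (A p).
  move=> sp0 i j ij; apply/matrixP => u v; rewrite mxE scalar_entry [RHS]mxE.
  have [ik|ik] := eqVneq i k.
    by rewrite ik; apply: spoke_eq0 => //; rewrite -ik eq_sym.
  have [jk|jk] := eqVneq j k; last exact: a0.
  by rewrite jk (scalar_conj _ k) (spoke_eq0 (sp0 i)) // rmorph0.
have [[p /bd]|[j hj]] := sum_prod_eq_prod_sum m1 (spoke_ge0 k) E.
  by left; exists p.
(* The hub has spoke 0 by convention, so if it is the common index then every spoke vanishes. *)
have [jk|jk] := eqVneq j k.
  left; exists (Ordinal m0); apply: bd => l.
  have [->|lj] := eqVneq l j; last exact: hj.
  by rewrite jk /spoke eqxx.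
right; exists k, j; split=> [|p i' j' ij' /negP]; first by rewrite eq_sym.
rewrite negb_or !negb_and => /andP[h1 h2].
have [ik|ik] := eqVneq i' k.
  move: h1; rewrite ik eqxx /= => j'j.
  by apply: spoke_eq0; [apply: hj | rewrite -ik eq_sym].
have [j'k|j'k] := eqVneq j' k; last exact: a0.
move: h2; rewrite j'k eqxx orbF => i'j.
by rewrite (scalar_conj _ k) (spoke_eq0 (hj p _ i'j)) // rmorph0.
Qed.

(** A single pair is an arrowhead with hub [i] and one spoke [j]; both sums reduce to
    [\prod_p spoke i p j]. *)
Lemma two_by_two_eq (i j : 'I_s) : i != j ->
  (forall p i' j', i' != j' ->
     ~ ((i' == i) && (j' == j) || (i' == j) && (j' == i)) -> a p i' j' = 0) ->
  \det (kr A) = oppenheim_bound A.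
Proof.
move=> ij h; apply/(arrowhead_eq (k := i)).
  by move=> p i' j' ij' /negbTE i'i /negbTE j'i; apply: h => //; rewrite i'i j'i andbF.
have sp0 p l : l != j -> spoke i p l = 0.
  move=> /negbTE lj; rewrite /spoke; case: ifPn => // li.
  rewrite (h p i l) ?mul0r //; first by rewrite eq_sym.
  by rewrite lj andbF (negbTE ij).
rewrite (bigD1 j) //= [X in _ + X]big1 => [|l lj]; last first.
  by rewrite (bigD1 (Ordinal m0)) //= sp0 // mul0r.
rewrite addr0; apply: eq_bigr => p _.
by rewrite (bigD1 j) //= big1 ?addr0 // => l; apply: sp0.
Qed.

End ScalarBlocks.

(** * Sufficient conditions: a block diagonal factor, a single factor *)

Lemma blkE s q (i : 'I_s) (k : 'I_q) : blk i k = mxtens_index (i, k).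
Proof. exact: val_inj. Qed.

Lemma det_block_diag (C : numClosedFieldType) s q (M : 'M[C]_(s * q)) :
  block_diag M -> \det M = \prod_i \det (block_of M i i).
Proof.
elim: s M => [|s IHs] M bM; first by rewrite big_ord0 det_mx00.
pose M' : 'M[C]_(q + s * q) := M.
have dl0 : dlsubmx M' = 0.
  apply/matrixP => a l; rewrite mxE [RHS]mxE.
  case: (mxtens_indexP a) => i k; rewrite -blkE.
  have /matrixP/(_ k l) := bM (lift ord0 i) ord0 isT.
  by rewrite !mxE blk_lift blk0.
rewrite -[LHS]/(\det M') -[M']submxK dl0 det_ublock big_ord_recl block_of00.
congr (_ * _); rewrite IHs => [|i j ij].
  by apply: eq_bigr => i _; rewrite block_of_lift.
by rewrite -block_of_lift bM // (inj_eq lift_inj).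
Qed.

Section EqualityCases.
Variables (C : numClosedFieldType) (m : nat) (t : 'I_m -> nat).
Hypothesis t0 : forall p, (0 < t p)%N.
Variables (s : nat) (A : forall p, 'M[C]_(s * t p)).

Lemma kr_index_blk p i (k : 'I_(#|KIdx t|)) :
  kr_index p (blk i k : 'I_(s * _)) = blk i ((enum_val k : KIdx t) p).
Proof. by rewrite [in LHS]blkE /kr_index mxtens_indexK. Qed.

Lemma block_of_kr i j : block_of (kr A) i j = tens (fun p => block_of (A p) i j).
Proof.
apply/matrixP => k l; rewrite !mxE; apply: eq_bigr => p _.
by rewrite !kr_index_blk mxE.
Qed.

(** A zero block in factor [p] makes the whole tensor zero, so [kr A] is block diagonal too; in the
    bound, the subtracted product vanishes through its factor at [p]. *)
Lemma block_diag_eq p : (forall q, pdmx (A q)) -> block_diag (A p) ->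
  \det (kr A) = oppenheim_bound A.
Proof.
move=> pA bp; rewrite det_block_diag => [|i j ij]; last first.
  rewrite block_of_kr; apply/matrixP => k l; rewrite mxE [RHS]mxE.
  by rewrite (bigD1 p) //= bp // mxE mul0r.
rewrite /oppenheim_bound [X in _ - X](bigD1 p) //=.
rewrite (det_block_diag bp) -prodrXl -/(diag_dets A p) subrr mul0r subr0.
rewrite /diag_dets exchange_big; apply: eq_bigr => i _.
by rewrite block_of_kr det_tens_pd // => q; apply: pdmx_block_of.
Qed.

(** Here [sigma] is 1, the bound has the form [D - (D - \det A)], and [kr A] is a reindexing of the
    only factor. *)
Lemma one_factor_eq : m = 1%N -> \det (kr A) = oppenheim_bound A.
Proof.
move=> m1; subst m.
have sg : sigma t ord0 = 1%N by rewrite /sigma big_ord1 divnn t0.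
have bg : bijective (@kr_index 1 t s ord0).
  apply: inj_card_bij; last by rewrite !card_ord card_KIdx big_ord1.
  move=> a b; case: (mxtens_indexP a) => i k; case: (mxtens_indexP b) => j l.
  rewrite /kr_index !mxtens_indexK !blkE /=.
  move/(can_inj (@mxtens_indexK _ _)) => [-> kl]; congr (mxtens_index (_, _)).
  by apply: enum_val_inj; apply/ffunP => p; rewrite (ord1 p).
rewrite /oppenheim_bound !big_ord1 sg expr1 subKr -(det_mxsub_bij _ bg).
by congr (\det _); apply/matrixP => a b; rewrite !mxE big_ord1.
Qed.

End EqualityCases.

(** * Semidefinite matrices *)

Section Limit.
Variable C : numClosedFieldType.

Lemma horner_bounded (f : {poly C}) :
  exists2 B, 0 <= B & forall e, 0 <= e <= 1 -> `|f.[e]| <= B.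
Proof.
elim/poly_ind: f => [|f c [B B0 hB]].
  by exists 0 => // e _; rewrite horner0 normr0.
exists (B + `|c|) => [|e e01]; first by rewrite addr_ge0.
rewrite !hornerE; apply: le_trans (ler_normD _ _) _; rewrite lerD2r normrM.
have /andP[e0 e1] := e01.
apply: le_trans (hB _ e01); by rewrite ler_piMr // ger0_norm.
Qed.

(** The order on [C] is partial, so nonnegativity of the value [c] at 0 is shown as equality with
    its norm. The values [w] at small [e > 0] equal their norms and lie within [e * B] of [c], which
    bounds the defect [D] by [e * (B + B)]. *)
Lemma horner0_ge0 (f : {poly C}) : (forall e, 0 < e -> 0 <= f.[e]) -> 0 <= f.[0].
Proof.
elim/poly_ind: f => [_|f c _ hf]; first by rewrite horner0.
have [B B0 hB] := horner_bounded f.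
rewrite !hornerE ?mulr0 ?add0r.
pose D := `|c - `|c| |.
have hD e : 0 < e -> e <= 1 -> D <= e * (B + B).
  move=> e0 e1; have /ger0_norm := hf e e0; rewrite !hornerE; set w := _ + c => Ew.
  have wc : `|w - c| <= e * B.
    rewrite addrK normrM mulrC (ger0_norm (ltW e0)) ler_pM2l // hB //.
    by rewrite ltW.
  have -> : D = `|(c - w) + (`|w| - `|c|)| by rewrite /D Ew addrA subrK.
  apply: le_trans (ler_normD _ _) _.
  rewrite mulrDr lerD //; first by rewrite distrC.
  exact: le_trans (ler_dist_dist _ _) wc.
have D0 : 0 <= D by apply: normr_ge0.
suff : D == 0 by rewrite normr_eq0 subr_eq0 => /eqP ->.
apply: contraT => nD; have {}D0 : 0 < D by rewrite lt_neqAle eq_sym nD D0.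
have BB0 : 0 <= B + B by rewrite addr_ge0.
have E0 : 0 < D + (B + B) by rewrite ltr_pwDl.
(* This [e] is at most 1 and makes [e * (B + B)] smaller than [D]. *)
have := hD (D / (D + (B + B))); rewrite divr_gt0 // ler_pdivrMr // mul1r lerDl.
by move=> /(_ isT BB0); rewrite mulrAC ler_pdivlMr // ler_pM2l // gerDr lt_geF.
Qed.

End Limit.

(* Over an arbitrary ring, so that it can be evaluated at [A p + 'X%:M], making the
   gap for [A p + e%:M] a polynomial in [e]. *)
Definition oppenheim_gap (R : comNzRingType) m s (t : 'I_m -> nat)
    (A : forall p, 'M[R]_(s * t p)) : R :=
  \det (khatri_rao A) -
  (\prod_(p < m) \prod_(i < s) \det (block_of (A p) i i) ^+ sigma t p
   - \prod_(p < m) (\prod_(i < s) \det (block_of (A p) i i) ^+ sigma t p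
                    - \det (A p) ^+ sigma t p)).

Lemma oppenheim_gap_map (R S : comNzRingType) (f : {rmorphism R -> S}) m s
    (t : 'I_m -> nat) (A : forall p, 'M[R]_(s * t p)) (B : forall p, 'M[S]_(s * t p)) :
  (forall p, B p = map_mx f (A p)) -> oppenheim_gap B = f (oppenheim_gap A).
Proof.
move=> BE.
have dB p : \prod_(i < s) \det (block_of (B p) i i) ^+ sigma t p =
    f (\prod_(i < s) \det (block_of (A p) i i) ^+ sigma t p).
  rewrite rmorph_prod; apply: eq_bigr => i _; rewrite rmorphXn -det_map_mx BE.
  by congr (\det _ ^+ _); apply/matrixP => k l; rewrite !mxE.
rewrite /oppenheim_gap !rmorphB !rmorph_prod -det_map_mx; congr (\det _ - (_ - _)).
- apply/matrixP => a b; rewrite !mxE rmorph_prod; apply: eq_bigr => p _.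
  by rewrite BE mxE.
- by apply: eq_bigr.
- by apply: eq_bigr => p _; rewrite dB BE rmorphB rmorphXn -det_map_mx.
Qed.

Theorem psd_oppenheim (C : numClosedFieldType) m s (t : 'I_m -> nat)
    (A : forall p, 'M[C]_(s * t p)) :
  (0 < m)%N -> (forall p, 0 < t p)%N -> (forall p, psdmx (A p)) ->
  oppenheim_bound A <= \det (khatri_rao A).
Proof.
move=> m0 t0 pA; rewrite -subr_ge0 -[_ - _]/(oppenheim_gap A).
pose AX p : 'M[{poly C}]_(s * t p) := map_mx polyC (A p) + 'X%:M.
have AXe e p : A p + e%:M = map_mx (horner_eval e) (AX p).
  apply/matrixP => i j; rewrite !mxE /horner_eval hornerD hornerC hornerMn.
  by rewrite hornerX.
have gapE e : oppenheim_gap (fun p => A p + e%:M) = (oppenheim_gap AX).[e].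
  exact: (oppenheim_gap_map (AXe e)).
have -> : oppenheim_gap A = (oppenheim_gap AX).[0].
  rewrite -gapE; apply: (oppenheim_gap_map (f := idfun)) => p.
  by rewrite map_mx_id // raddf0 addr0.
apply: horner0_ge0 => e e0; rewrite -gapE subr_ge0 det_khatri_rao.
apply: pd_oppenheim => // p; apply: pdmxD => //.
by rewrite -diag_const_mx; apply: pdmx_diag => i; rewrite mxE.
Qed.

Theorem mainTheorem1 (R : realType) (m s : nat) (t : 'I_m -> nat)
  (A : forall p : 'I_m, 'M[R[i]]_(s * t p)) :
  (0 < m)%N -> (0 < s)%N -> (forall p, 0 < t p)%N ->
  (forall p, psdmx (A p)) ->
  (\det (khatri_rao A) >=
     \prod_(p < m) \prod_(i < s) \det (block_of (A p) i i) ^+ sigma t p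
   - \prod_(p < m) (\prod_(i < s) \det (block_of (A p) i i) ^+ sigma t p
                    - \det (A p) ^+ sigma t p))
  /\
  ((forall p, pdmx (A p)) ->
   (\det (khatri_rao A) =
     \prod_(p < m) \prod_(i < s) \det (block_of (A p) i i) ^+ sigma t p
   - \prod_(p < m) (\prod_(i < s) \det (block_of (A p) i i) ^+ sigma t p
                    - \det (A p) ^+ sigma t p)
    <->
    [\/ (m = 1%N \/ s = 1%N),
        (exists p, block_diag (A p))
      | (forall p, t p = 1%N) /\
        exists i j : 'I_s, i != j /\
          forall (p : 'I_m) (i' j' : 'I_s) (k : 'I_(t p)) (l : 'I_(t p)),
            i' != j' -> ~ ((i' == i) && (j' == j) || (i' == j) && (j' == i)) ->
            A p (blk i' k) (blk j' l) = 0])).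
Proof.
move=> m0 s0 t0 pA; split; first exact: psd_oppenheim.
move=> pdA; rewrite det_khatri_rao.
rewrite -[X in _ = X]/(oppenheim_bound A); split.
  move=> E; have [m1|m1] := ltnP 1 m; last first.
    by constructor 1; left; apply/eqP; rewrite eqn_leq m1 m0.
  have [[p bp]|[t1 [k hk]]] := pd_oppenheim_eq m0 t0 pdA m1 E.
    by constructor 2; exists p.
  have [|[p bp]|[i [j [ij h]]]] := arrowhead_eq_cases m0 (t1 := t1) pdA (k := k) m1 _ E.
  - move=> p i j ij ik jk.
    (* [hk] speaks only of entries above the diagonal; Hermitian symmetry supplies those below. *)
    have h0 (u v : 'I_s) : (u < v)%N -> u != k -> scalar_mx_of t1 A p u v = 0.
      move=> uv /(hk p _ _ uv)/matrixP/(_ (Ordinal (t0 p)) (Ordinal (t0 p))).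
      by rewrite mxE scalar_entry => ->; rewrite mxE.
    move: ij; rewrite neq_ltn => /orP[ij|ji]; first exact: h0.
    by rewrite scalar_conj // h0 // rmorph0.
  - by constructor 2; exists p.
  constructor 3; split=> //; exists i, j; split=> // p i' j' u v ij' nij.
  by rewrite scalar_entry h.
case=> [[m1|s1]|[p bp]|[t1 [i [j [ij h]]]]].
- exact: one_factor_eq.
(* With a single block, every [A p] is block diagonal. *)
- apply: (@block_diag_eq _ _ _ t0 _ A (Ordinal m0)) => // i j.
  by subst s; rewrite !ord1.
- exact: block_diag_eq bp.
apply: (two_by_two_eq m0 (t1 := t1) pdA ij) => p i' j' ij' nij.
by rewrite mxE; apply: h.
Qed.
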